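(* Let $\mathbb{K}$ be a commutative ring and $V$ a free $\mathbb{K}$-module with a fixed basis $\mathcal{V}$. The set of monomials in normal form gives a basis of the $\mathbb{K}$-module $\Gamma(RT,V)$.
   Context: Operad $PreLie=RT$. An $n$-tree is a finite non-empty connected acyclic graph with a distinguished vertex (the root) and a bijection between its vertices and $\{1,\ldots,n\}$ (trees are not planar); edges are oriented towards the root, and $In(\tau,i)$ is the set of edges entering vertex $i$. $\mathcal{RT}(n)$ is the set of $n$-trees, with $\mathbb{S}_n$ acting by relabelling, and $RT(n)=\mathbb{K}[\mathcal{RT}(n)]$. For $\tau\in\mathcal{RT}(m)$, $\upsilon\in\mathcal{RT}(n)$, $\tau\circ_i\upsilon=\sum_{f:In(\tau,i)\to\{1,\ldots,n\}}\tau\circ_i^f\upsilon$, where $\tau\circ_i^f\upsilon$ is obtained by substituting $\upsilon$ for vertex $i$, attaching the outgoing edge of $i$ (if any) to the root of $\upsilon$, each incoming edge $e$ to vertex $f(e)$, and relabelling with the usual shift. $S(RT,V)=\bigoplus_n(RT(n)\otimes V^{\otimes n})_{\mathbb{S}_n}$, $\Gamma(RT,V)=\bigoplus_n(RT(n)\otimes V^{\otimes n})^{\mathbb{S}_n}$ for the diagonal action ($\sigma$ relabels vertex $i$ as $\sigma(i)$ and moves the $i$-th letter to position $\sigma(i)$). With $P=RT$ and $(M\boxtimes N)(n)=\bigoplus_{i+j=n}\mathrm{Ind}_{\mathbb{S}_i\times\mathbb{S}_j}^{\mathbb{S}_n}M(i)\otimes N(j)$, the trace (sum over the group) is an isomorphism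 $\bigoplus_r(P(r)\otimes P^{\boxtimes r})_{\mathbb{S}_r}\cong\bigoplus_r(P(r)\otimes P^{\boxtimes r})^{\mathbb{S}_r}$; its inverse followed by operadic composition induces the monad multiplication $\tilde\mu:\Gamma(P,\Gamma(P,V))\to\Gamma(P,V)$. $\mathcal{S}(\mathcal{RT},\mathcal{V})$ is the basis of $S(RT,V)$ consisting of the classes $\tau(x_1,\ldots,x_n)$ of $\tau\otimes x_1\otimes\cdots\otimes x_n$ with $\tau\in\mathcal{RT}(n)$, $x_i\in\mathcal{V}$. For such $\mathtt{t}$, $\mathcal{O}\mathtt{t}\in\Gamma(RT,V)$ is the sum of the distinct elements of the $\mathbb{S}_n$-orbit of $\tau\otimes x_1\otimes\cdots\otimes x_n$. The elements $\mathcal{O}\mathtt{t}$ form a basis of $\Gamma(RT,V)$, and orbit sums in $\Gamma(RT,\Gamma(RT,V))$ are formed with respect to it. For $x\in V$, write $x$ also for $\mathcal{O}$ of the one-vertex tree decorated by $x$. $F_r$ is the $(r+1)$-tree with root $1$ and all other vertices attached directly to the root. Monomials in normal form are the iterated compositions of elements $\mathcal{O}F_r(x,-,\ldots,-)$, $r\ge0$, whose root entry $x$ is an element of $\mathcal{V}$: formal monomials $M$ defined inductively as $\mathcal{O}F_r(x,M_1,\ldots,M_r)$ with $x\in\mathcal{V}$ and $M_1,\ldots,M_r$ monomials, taken up to permutation of the non-root entries $M_1,\ldots,M_r$, and regarded as elements of $\Gamma(RT,V)$ by the evaluation $M\mapsto\tilde\mu(\mathcal{O}F_r(x,\mathrm{ev}(M_1),\ldots,\mathrm{ev}(M_r)))$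 (each $\mathrm{ev}(M_i)$ is of the form $\mathcal{O}\mathtt{t}_i$ with $\mathtt{t}_i\in\mathcal{S}(\mathcal{RT},\mathcal{V})$). *)

(* Defs.v *)
From HB Require Import structures.
From mathcomp Require Import all_boot all_order all_algebra all_fingroup.
From mathcomp Require classical_sets.
From mathcomp Require Import boolp.
From mathcomp Require Import finmap monalg generic_quotient.

Set Implicit Arguments.
Unset Strict Implicit.
Unset Printing Implicit Defensive.

Import GRing.Theory.
Local Open Scope ring_scope.
Local Open Scope quotient_scope.

(* K[B], the free K-module on B: finitely supported functions B -> K, where   *)
(* << b >> is the basis element b, g@_b a coefficient, msupp g the support.   *)
(* The library only makes {malg K[B]} a module over a non-trivial ring, hence *)
(* the alias.                                                                 *)
Definition freemod (K : comPzRingType) (B : choiceType) : Type := {malg K[B]}.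

HB.instance Definition _ (K : comPzRingType) (B : choiceType) :=
  GRing.Zmodule.on (freemod K B).

Section FreeModule.
Variables (K : comPzRingType) (B : choiceType).
Implicit Types (g : freemod K B) (c : K) (b : B).

Definition fm_scale c g : freemod K B := \sum_(b <- msupp g) << c * g@_b *g b >>.

Lemma fm_scaleE c g b : (fm_scale c g)@_b = c * g@_b.
Proof.
rewrite {2}[g]monalgE /fm_scale !raddf_sum mulr_sumr.
by apply/eq_bigr=> /= i _; rewrite !mcoeffU mulrnAr.
Qed.

Lemma fm_scaleA c1 c2 g : fm_scale c1 (fm_scale c2 g) = fm_scale (c1 * c2) g.
Proof. by apply/malgP=> x; rewrite !fm_scaleE mulrA. Qed.

Lemma fm_scale1r : left_id 1 fm_scale.
Proof. by move=> g; apply/malgP=> k; rewrite !fm_scaleE mul1r. Qed.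

Lemma fm_scaleDr : right_distributive fm_scale +%R.
Proof.
by move=> c g1 g2; apply/malgP=> k; rewrite !(mcoeffD, fm_scaleE) mulrDr.
Qed.

Lemma fm_scaleDl g : {morph fm_scale^~ g : c1 c2 / c1 + c2}.
Proof.
by move=> c1 c2; apply/malgP=> k; rewrite !(mcoeffD, fm_scaleE) mulrDl.
Qed.

HB.instance Definition _ := GRing.Zmodule_isLmodule.Build K (freemod K B)
  fm_scaleA fm_scale1r fm_scaleDr fm_scaleDl.

Lemma fm_coeffZ c g b : (c *: g)@_b = c * g@_b.
Proof. exact: fm_scaleE. Qed.

Definition fm_elt b : freemod K B := << b >>.

Definition lin_ext (M : lmodType K) (f : B -> M) g : M :=
  \sum_(b <- msupp g) g@_b *: f b.

Lemma lin_extEw (M : lmodType K) (f : B -> M) g (d : {fset B}) :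
  (msupp g `<=` d)%fset -> lin_ext f g = \sum_(b <- d) g@_b *: f b.
Proof.
move=> gd; rewrite /lin_ext (big_fset_incl _ gd) //= => b _.
by move=> /mcoeff_outdom ->; rewrite scale0r.
Qed.

Lemma lin_ext_is_linear (M : lmodType K) (f : B -> M) : linear (lin_ext f).
Proof.
move=> c g1 g2; pose d := (msupp (c *: g1 + g2 : freemod K B) `|` (msupp g1 `|` msupp g2))%fset.
have sub1 : (msupp g1 `<=` d)%fset by apply/fsubsetP => b h; rewrite !in_fsetU h !orbT.
have sub2 : (msupp g2 `<=` d)%fset by apply/fsubsetP => b h; rewrite !in_fsetU h !orbT.
rewrite (lin_extEw f sub1) (lin_extEw f sub2) (@lin_extEw _ f _ d (fsubsetUl _ _)).
rewrite scaler_sumr -big_split /=; apply: eq_bigr => b _.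
by rewrite mcoeffD fm_coeffZ scalerDl scalerA.
Qed.

HB.instance Definition _ (M : lmodType K) (f : B -> M) :=
  GRing.isLinear.Build K (freemod K B) M _ (lin_ext f) (lin_ext_is_linear f).

Lemma lin_ext_elt (M : lmodType K) (f : B -> M) b : lin_ext f (fm_elt b) = f b.
Proof.
by rewrite (@lin_extEw _ f _ [fset b]%fset msuppU_le) big_seq_fset1 mcoeffUU scale1r.
Qed.

Lemma fm_coeff_elt b b' : (fm_elt b)@_b' = (b == b')%:R.
Proof. by rewrite mcoeffU. Qed.

Lemma fm_coeff_sum (I : Type) (r : seq I) (P : pred I) (F : I -> freemod K B) b :
  (\sum_(i <- r | P i) F i)@_b = \sum_(i <- r | P i) (F i)@_b.
Proof. exact: raddf_sum. Qed.

End FreeModule.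

Arguments fm_elt {K B} b.

Definition is_basis_of (K : comPzRingType) (M : lmodType K) (S : M -> Prop)
    (I : choiceType) (e : I -> M) : Prop :=
  [/\ forall i, S (e i),
      forall c : freemod K I, lin_ext e c = 0 -> c = 0
    & forall v, S v -> exists c : freemod K I, v = lin_ext e c].

(* ------------------------------------------------------------------------ *)

(* A rooted tree whose vertices form a subset of T: the pair (vertex set,     *)
(* function sending a vertex to the target of its outgoing edge, None for the *)
(* root). The value outside of the vertex set is normalised to None.          *)
Section LTree.
Variable T : finType.

Definition is_ltree (t : {set T} * {ffun T -> option T}) : bool :=
  [forall j, (j \notin t.1) ==> (t.2 j == None)] &&
  [exists r in t.1, (t.2 r == None) &&
     [forall j in t.1, connect [rel a b | t.2 a == Some b] j r]].

Record ltree := LTree { ltree_val : {set T} * {ffun T -> option T};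
                        _ : is_ltree ltree_val }.
HB.instance Definition _ := [isSub for ltree_val].
HB.instance Definition _ := [Finite of ltree by <:].

Definition vertices (t : ltree) : {set T} := (ltree_val t).1.
Definition out (t : ltree) : {ffun T -> option T} := (ltree_val t).2.

Definition In_edges (t : ltree) (i : T) : {set T} :=
  [set j in vertices t | out t j == Some i].

Lemma ltreeP (t : ltree) :
  (forall j, j \notin vertices t -> out t j = None) /\
  exists2 r, r \in vertices t /\ out t r = None &
    forall j, j \in vertices t -> connect [rel a b | out t a == Some b] j r.
Proof.
rewrite /vertices /out; have : is_ltree (ltree_val t) by exact: valP.
case: (ltree_val t) => A p /=.
move=> /andP[/forallP h0 /existsP[r /and3P[rA /eqP pr /forallP h]]].
split=> [j jA|]; first by have /implyP/(_ jA)/eqP := h0 j.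
by exists r => // j jA; have /implyP := h j; apply.
Qed.

Lemma is_ltreeP (A : {set T}) (p : {ffun T -> option T}) :
  (forall j, j \notin A -> p j = None) ->
  (exists2 r, r \in A /\ p r = None &
    forall j, j \in A -> connect [rel a b | p a == Some b] j r) ->
  is_ltree (A, p).
Proof.
move=> h0 [r [rA pr] h]; apply/andP; split.
  by apply/forallP => j; apply/implyP => /h0 /= ->.
apply/existsP; exists r; rewrite /= rA pr eqxx /=.
by apply/forallP => j; apply/implyP => /h.
Qed.

Lemma out_vertices (t : ltree) j k :
  out t j = Some k -> j \in vertices t /\ k \in vertices t.
Proof.
have [h0 [r [rA pr] h]] := ltreeP t => jk.
have jA : j \in vertices t by apply: contraTT isT => /h0; rewrite jk.
split=> //; apply: contraTT isT => kA.
have /connectP[[|x q] /= eq_q lq] := h j jA.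
  by move: pr; rewrite lq jk.
move: eq_q => /andP[/eqP]; rewrite jk => -[kx]; rewrite -kx in lq *.
case: q lq => [|y q] /= lq; first by rewrite lq (negbTE kA) in rA.
by rewrite (h0 _ kA).
Qed.

End LTree.

Lemma omap_out_connect (S T : finType) (h : S -> T) (p : S -> option S)
    (q : T -> option T) (j r : S) :
  (forall a b, p a = Some b -> q (h a) = Some (h b)) ->
  connect [rel a b | p a == Some b] j r ->
  connect [rel a b | q a == Some b] (h j) (h r).
Proof.
move=> hpq /connectP[s ps ->]; elim: s j ps => [|x s IH] j //=.
move=> /andP[/eqP jx /IH]; apply: connect_trans.
by apply: connect1; rewrite /= (hpq _ _ jx).
Qed.

Section Relabel.
Variables (S T : finType) (h : S -> T) (h_inj : injective h).

Definition relabel_val (t : ltree S) : {set T} * {ffun T -> option T} :=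
  (h @: vertices t,
   [ffun z => if [pick j | h j == z] is Some j then omap h (out t j) else None]).

Lemma relabel_outE (t : ltree S) j : (relabel_val t).2 (h j) = omap h (out t j).
Proof.
rewrite ffunE; case: pickP => [k /eqP /h_inj ->//|/(_ j)].
by rewrite eqxx.
Qed.

Lemma relabel_subproof (t : ltree S) : is_ltree (relabel_val t).
Proof.
have [h0 [r [rA pr] hc]] := ltreeP t.
apply: is_ltreeP => [j jA|].
  rewrite ffunE; case: pickP => // k /eqP hk.
  rewrite h0 //; apply: contra jA => kA; rewrite -hk; exact: imset_f.
exists (h r); first by split; rewrite ?imset_f ?relabel_outE ?pr.
move=> _ /imsetP[j jA ->]; apply: omap_out_connect (hc j jA) => a b ab.
by rewrite relabel_outE ab.
Qed.

Definition relabel (t : ltree S) : ltree T := LTree (relabel_subproof t).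

Lemma vertices_relabel t : vertices (relabel t) = h @: vertices t.
Proof. by []. Qed.

End Relabel.

(* RT(n), with 'I_n as set of labels. *)
Record RT (n : nat) := MkRT { rt_tree :> ltree 'I_n;
                              _ : vertices rt_tree == [set: 'I_n] }.
HB.instance Definition _ n := [isSub for @rt_tree n].
HB.instance Definition _ n := [Finite of RT n by <:].

Lemma vertices_RT n (t : RT n) : vertices t = [set: 'I_n].
Proof. by case: t => t /= /eqP. Qed.

Lemma rt_act_subproof n (s : 'S_n) (t : RT n) :
  vertices (relabel (@perm_inj _ s) t) == [set: 'I_n].
Proof.
rewrite vertices_relabel vertices_RT; apply/eqP/setP => i; rewrite !inE.
by apply/imsetP; exists (s^-1%g i); rewrite ?inE ?permKV.
Qed.

Definition rt_act n (s : 'S_n) (t : RT n) : RT n := MkRT (rt_act_subproof s t).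

(* Forgetting the orientation identifies RT(n) with the connected acyclic     *)
(* graphs on 'I_n with a distinguished vertex.                                *)
Definition adjacent n (t : RT n) : rel 'I_n :=
  [rel i j | (out t i == Some j) || (out t j == Some i)].

Definition is_rooted_tree n (r : 'I_n) (e : rel 'I_n) : Prop :=
  [/\ symmetric e, irreflexive e, forall i j, connect e i j
    & forall c : seq 'I_n, ucycle e c -> size c <= 2]%N.

Section RootedTrees.
Variable n : nat.
Implicit Types (t : RT n) (e : rel 'I_n) (i j r : 'I_n).

Lemma out_acyclic t i j : out t i = Some j ->
  ~~ connect [rel a b | out t a == Some b] j i.
Proof.
set s := [rel a b | _] => ij; apply/negP => ji.
have back k : connect s i k -> connect s k i.
  move=> /connectP[p]; elim/last_ind: p k => [|p y IH] k /=; first by move=> _ ->.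
  rewrite rcons_path last_rcons => /andP[/IH/(_ erefl) /connectP[[|z q] /= pq lq]].
    by move=> /eqP; rewrite -lq ij => -[<-] ->.
  move=> /eqP sy ->; move: pq => /andP[/eqP]; rewrite sy => -[->] pq.
  by apply/connectP; exists q.
have [_ [r [_ pr] hc]] := ltreeP t.
have /hc/back/connectP[[|z q] /=] : i \in vertices t by rewrite vertices_RT inE.
  by move=> _ e; move: pr; rewrite -e ij.
by rewrite pr.
Qed.

Lemma RT_is_rooted_tree t r : out t r = None -> is_rooted_tree r (adjacent t).
Proof.
move=> pr; have [_ [r' [_ pr'] hc]] := ltreeP t.
have irr i j : out t i = Some j -> i != j.
  by move=> ij; apply: contraNneq (out_acyclic ij) => ->; apply: connect0.
have sy : symmetric (adjacent t) by move=> i j; rewrite /adjacent /= orbC.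
have cr i : connect (adjacent t) i r'.
  have : i \in vertices t by rewrite vertices_RT inE.
  by move=> /hc; apply: connect_sub => a b /= ab; apply: connect1; apply/orP; left.
split=> //.
- by move=> i; rewrite /adjacent /= orbb; apply/eqP => /irr; rewrite eqxx.
- by move=> i j; apply: connect_trans (cr i) _; rewrite (sym_connect_sym sy).
pose d i := #|[set k | connect [rel a b | out t a == Some b] i k]|.
have dlt i j : out t i = Some j -> (d j < d i)%N.
  move=> ij; apply/proper_card/properP; split.
    apply/subsetP => k; rewrite !inE; apply: connect_trans.
    by apply: connect1; rewrite /= ij.
  by exists i; rewrite inE ?connect0 // out_acyclic.
move=> c /andP[cc uc]; rewrite leqNgt; apply/negP => c3.
case: c cc uc c3 => // x0 c0; set c := x0 :: c0 => cc uc c3.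
case: (@arg_maxnP _ x0 (fun x => x \in c) d); first exact: mem_head.
move=> x xc xmax.
have nb y : y \in c -> adjacent t x y -> out t x = Some y.
  move=> yc /orP[/eqP //|/eqP /dlt].
  by rewrite ltnNge => /negP; case; apply: xmax.
have [k c' ec] := rot_to xc.
have c'c y : y \in x :: c' -> y \in c by rewrite -ec mem_rot.
have : path.cycle (adjacent t) (x :: c') by rewrite -ec rot_cycle.
have : uniq (x :: c') by rewrite -ec rot_uniq.
have : (2 < size (x :: c'))%N by rewrite -ec size_rot.
case: c' {ec} c'c => [|y [|z c']] // c'c _ uc' cc'.
have xy : out t x = Some y.
  apply: nb; first by rewrite c'c // !inE eqxx orbT.
  by case/andP: cc'.
have xl : out t x = Some (last z c').
  apply: nb; first by rewrite c'c // 2!in_cons mem_last !orbT.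
  have : path (adjacent t) x (rcons [:: y, z & c'] x) by exact: cc'.
  by rewrite rcons_path sy => /andP[].
move: uc'; rewrite !cons_uniq => /and4P[_ yz _ _].
move: xl yz; rewrite xy => -[->]. by rewrite mem_last.
Qed.

Lemma rooted_tree_RT r e : is_rooted_tree r e ->
  exists! t : RT n, out t r = None /\ e =2 adjacent t.
Proof.
case=> esym eirr econ eacyc.
have bridge i j : e i j -> ~~ connect [rel a b | e a b && ((a, b) != (i, j))
                                   && ((a, b) != (j, i))] j i.
  move=> ij; apply/negP => /connectP[p0 pp0 lp0].
  case/shortenP: pp0 lp0 => p pp up _ lp {p0}.
  have pe : path e j p by apply: sub_path pp => a b /= /andP[/andP[]].
  have : (size (j :: p) <= 2)%N.
    by apply: eacyc; rewrite /ucycle up /= rcons_path pe -lp ij.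
  case: p pp lp {pe up} => [|x [|//]] /=.
    by move=> _ ji; rewrite ji eirr in ij.
  by move=> /andP[/andP[_ jx] _] ix; rewrite ix eqxx in jx.
pose av i := [rel a b | [&& e a b, a != i & b != i]].
have av_path i j k p : i \notin j :: p -> path e j p -> k = last j p ->
    connect (av i) j k.
  move=> ip pp ->; apply/connectP; exists p => //.
  elim: p j ip pp => //= x p IH j; rewrite !inE !negb_or => /and3P[ij ix ip].
  move=> /andP[jx /IH] -> //; first by rewrite jx (eq_sym j) ij (eq_sym x) ix.
  by rewrite inE negb_or ix.
have av_notin i j : connect (av i) j r -> j != r -> j != i.
  move=> /connectP[[|x p] /=]; first by move=> _ ->; rewrite eqxx.
  by move=> /andP[/and3P[]].
have r_av i j : i != r -> e i j -> connect (av i) j r -> forall k, e i k ->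
    connect (av i) k r -> j = k.
  move=> ir ij jr k ik kr; apply/eqP; apply: contraT => jk.
  have avs : symmetric (av i).
    by move=> a b; rewrite /= esym; congr (_ && _); rewrite andbC.
  case/negP: (bridge i j ij); rewrite (sym_connect_sym _); last first.
    move=> a b; rewrite /= esym -!andbA; congr (_ && _); rewrite andbC.
    by rewrite !xpair_eqE ![(b == _) && _]andbC.
  apply: (@connect_trans _ _ k).
    apply: connect1; rewrite /= ik !xpair_eqE (eq_sym k) (negbTE jk) andbF /=.
    by rewrite negb_and; case: eqP => //= ij'; rewrite ij' eirr in ij.
  have : connect (av i) k j.
    by apply: connect_trans kr _; rewrite (sym_connect_sym avs).
  apply: connect_sub => a b /= /and3P[ab ai bi]; apply: connect1.
  by rewrite /= ab !xpair_eqE (negbTE ai) (negbTE bi) andbF.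
pose p := [ffun i => if i == r then None else
                     [pick j | e i j && connect (av i) j r]].
have pE i j : i != r -> e i j -> connect (av i) j r -> p i = Some j.
  move=> ir ij jr; rewrite ffunE (negbTE ir); case: pickP => [k /andP[ik kr]|/(_ j)].
    by rewrite (r_av _ _ ir ij jr k ik kr).
  by rewrite ij jr.
have pe i j : p i = Some j -> e i j.
  rewrite ffunE; case: ifP => // _; case: pickP => // k /andP[ik _] [<-] //.
have upath i : exists2 q, path e i q & uniq (i :: q) && (r == last i q).
  have /connectP[q0 pq lq] := econ i r; case/shortenP: pq lq => q pq uq _ lq.
  by exists q => //; rewrite uq -lq eqxx.
have pstep i j q : path e i (j :: q) -> uniq [:: i, j & q] -> r = last j q ->
    p i = Some j.
  move=> /= /andP[ij pq] /andP[iq _] lq; apply: pE => //; last exact: av_path pq lq.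
  by apply: contraNneq iq => ->; rewrite lq mem_last.
have p_tree : is_ltree ([set: 'I_n], p).
  apply: is_ltreeP => [j|]; first by rewrite inE.
  exists r; first by rewrite inE ffunE eqxx.
  move=> j _; have [q pq /andP[uq /eqP lq]] := upath j.
  apply/connectP; exists q => //; elim: q j pq uq lq => //= x q IH j pq uq lq.
  have /= -> := pstep _ _ _ pq uq lq; rewrite eqxx /=.
  by apply: IH => //; [case/andP: pq|case/andP: uq].
have p_full : vertices (LTree p_tree) == [set: 'I_n] by [].
pose t : RT n := MkRT p_full.
have tr : out t r = None by rewrite /out /= ffunE eqxx.
have te : e =2 adjacent t.
  move=> i j; apply/idP/orP => [ij|[/eqP/pe //|/eqP/pe]]; last by rewrite esym.
  have [q pq /andP[uq /eqP lq]] := upath i.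
  have [jq|jq] := boolP (j \in i :: q).
    left; case: q pq uq lq jq => [|x q] pq uq lq jq.
      by move: jq ij; rewrite inE => /eqP ->; rewrite eirr.
    have [<-|xj] := eqVneq x j; first by apply/eqP/(pstep _ _ _ pq).
    case/negP: (bridge i j ij).
    rewrite (sym_connect_sym _); last first.
      move=> a b; rewrite /= esym -!andbA; congr (_ && _); rewrite andbC.
      by rewrite !xpair_eqE ![(b == _) && _]andbC.
    have ji : j != i by apply: contraTneq ij => ->; rewrite eirr.
    move: pq uq => /= /andP[ix pq] /andP[iq uq].
    apply: (@connect_trans _ _ x).
      apply: connect1; rewrite /= ix !xpair_eqE (negbTE xj) andbF /= negb_and.
      by rewrite (eq_sym i) ji.
    have jxq : j \in x :: q by move: jq; rewrite inE (negbTE ji).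
    have : connect (av i) x j.
      have [q1 [jl [pq1 iq1]]] : exists q1, j = last x q1 /\ path e x q1 /\ i \notin x :: q1.
        case/splitPl: jxq pq iq {uq lq jq} => q1 q2 lq1; rewrite cat_path -cat_cons mem_cat negb_or.
        by move=> /andP[p1 _] /andP[i1 _]; exists q1.
      exact: av_path iq1 pq1 jl.
    apply: connect_sub => a b /= /and3P[ab ai bi]; apply: connect1.
    by rewrite /= ab !xpair_eqE (negbTE ai) (negbTE bi) andbF.
  right; apply/eqP; apply: (pstep j i q) => //; first by rewrite /= esym ij.
  by rewrite cons_uniq jq.
exists t; split=> // t' [t'r t'e].
have [_ [r' [_ pr'] hc]] := ltreeP t'.
have rr' : r = r'.
  have : r \in vertices t' by rewrite vertices_RT inE.
  by move=> /hc /connectP[[|z q] //=]; rewrite t'r.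
have out' i j : out t' i = Some j -> out t i = Some j.
  move=> ij; apply: pE.
  - by apply: contra_eq_neq ij => ->; rewrite t'r.
  - by rewrite t'e /adjacent /= ij eqxx.
  have : j \in vertices t' by rewrite vertices_RT inE.
  move=> /hc /connectP[q pq lq]; rewrite rr'.
  apply: (@av_path i j r' q) => //.
    apply/negP => iq; case/splitPl: iq pq lq => q1 q2 lq1; rewrite cat_path => /andP[pq1 _] _.
    by have /negP := out_acyclic ij; case; apply/connectP; exists q1.
  by apply: sub_path pq => a b /= ab; rewrite t'e /adjacent /= ab.
apply/val_inj/val_inj; rewrite [RHS]surjective_pairing [LHS]surjective_pairing.
congr (_, _).
  by have := vertices_RT t'; rewrite /vertices => ->.
apply/ffunP => i; have : out t' i = out t i; last by [].
case e' : (out t' i) => [j|]; first by rewrite (out' _ _ e').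
have : i \in vertices t' by rewrite vertices_RT inE.
move=> /hc /connectP[[|z q] /=]; last by rewrite e'.
by move=> _; rewrite -rr' => <-.
Qed.

End RootedTrees.

Definition word_act n (X : Type) (s : 'S_n) (x : n.-tuple X) : n.-tuple X :=
  [tuple tnth x (s^-1%g i) | i < n].

(* F_r, with root ord0 *)
Lemma corolla_subproof1 r : is_ltree ([set: 'I_r.+1],
  [ffun j : 'I_r.+1 => if j == ord0 then None else Some ord0]).
Proof.
apply: is_ltreeP => [j|]; first by rewrite inE.
exists ord0; first by rewrite inE ffunE eqxx.
move=> j _; have [->|j0] := eqVneq j ord0; first exact: connect0.
by apply: connect1; rewrite /= ffunE (negbTE j0).
Qed.

Lemma corolla_subproof2 r :
  vertices (LTree (corolla_subproof1 r)) == [set: 'I_r.+1].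
Proof. by []. Qed.

Definition corolla r : RT r.+1 := MkRT (corolla_subproof2 r).

(* ------------------------------------------------------------------------ *)

(* Partial composition t o_i u, for trees with disjoint sets of labels (so    *)
(* that no shift of the labels is needed). The sum is over the functions      *)
(* f : In(t,i) -> vertices u, extended by the value i outside of In(t,i).     *)
Section PartialComposition.
Variables (K : comPzRingType) (T : finType).

Definition subst_val (t : ltree T) (i : T) (u : ltree T) (f : {ffun T -> T}) :
    {set T} * {ffun T -> option T} :=
  (vertices t :\ i :|: vertices u,
   [ffun j => if j \in vertices u then
                (if out u j is Some k then Some k else out t i)
              else if j == i then None
              else if j \in In_edges t i then Some (f j)
              else out t j]).

Definition pcomp (t : ltree T) (i : T) (u : ltree T) : freemod K (ltree T) :=
  \sum_(f in pffun_on i (mem (In_edges t i)) (mem (vertices u)))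
    \sum_(w : ltree T | ltree_val w == subst_val t i u f) fm_elt w.

(* The inner sum above has exactly one term. *)
Lemma subst_is_ltree t i u (f : {ffun T -> T}) :
  i \in vertices t -> [disjoint vertices t & vertices u] ->
  f \in pffun_on i (mem (In_edges t i)) (mem (vertices u)) ->
  is_ltree (subst_val t i u f).
Proof.
move=> iA dis /pffun_onP[_ fim].
have [t0 [r [rA pr] rc]] := ltreeP t.
have [u0 [s [sB qs] sc]] := ltreeP u.
have tNu j : j \in vertices t -> j \in vertices u = false.
  by move=> jA; apply: (disjointFr dis).
set q := (subst_val t i u f).2.
have qu j k : out u j = Some k -> q j = Some k.
  by move=> jk; have [jB _] := out_vertices jk; rewrite ffunE jB jk.
have qs' : q s = out t i by rewrite ffunE sB qs.
have qin j : j != i -> out t j = Some i -> exists2 k, k \in vertices u & q j = Some k.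
  move=> ji jti; have [jA _] := out_vertices jti.
  have jin : j \in In_edges t i by rewrite inE jA jti eqxx.
  exists (f j); last by rewrite ffunE (tNu _ jA) (negbTE ji) jin.
  by apply: fim; apply/mapP; exists j; rewrite ?mem_enum.
have qout j : j \in vertices t -> j != i -> out t j != Some i -> q j = out t j.
  move=> jA ji jti.
  by rewrite ffunE (tNu _ jA) (negbTE ji) inE (negbTE jti) andbF.
have cu j : j \in vertices u -> connect [rel a b | q a == Some b] j s.
  by move=> /sc; apply: (@omap_out_connect _ _ id) => a b; apply: qu.
apply: is_ltreeP => [j|].
  rewrite in_setU in_setD1 !negb_or negb_and negbK => /andP[hj jB].
  rewrite ffunE (negbTE jB); case: eqP => //= /eqP ji.
  rewrite (negbTE ji) /= in hj.
  by rewrite inE (negbTE hj) /= t0.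
have [r' [r'V qr'] rr'] : exists2 r', r' \in (subst_val t i u f).1 /\ q r' = None
   & (if r == i then s else r) = r'.
  case: (eqVneq r i) => [ri|ri]; last first.
    exists r => //; split; first by rewrite in_setU in_setD1 ri rA.
    by rewrite qout // pr.
  exists s => //; split; first by rewrite in_setU sB orbT.
  by rewrite qs' -ri.
exists r' => // j.
suff ct k : k \in vertices t ->
    connect [rel a b | q a == Some b] (if k == i then s else k) r'.
  rewrite in_setU => /orP[/setD1P[ji /ct]|/cu js]; first by rewrite (negbTE ji).
  by apply: connect_trans js _; have := ct i iA; rewrite eqxx.
move=> /rc /connectP[p].
elim: p k => [|x p IH] k /= => [_ <-|/andP[/eqP kx pp] lp].
  by rewrite rr' connect0.
apply: connect_trans (IH x pp lp).
have [ki|ki] := eqVneq k i.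
  have [xi|xi] := eqVneq x i; first exact: connect0.
  by apply: connect1; rewrite /= qs' -ki kx.
have [xi|xi] := eqVneq x i.
  rewrite xi in kx; have [y yB qk] := qin _ ki kx.
  by apply: connect_trans (cu y yB); apply: connect1; rewrite /= qk.
have [kA _] := out_vertices kx.
apply: connect1; rewrite /= qout // kx //.
Qed.

End PartialComposition.

(* The basis of RT^{[x]r}(n): in coordinates, the induced module              *)
(* Ind RT(i_1) (x) ... (x) RT(i_r) is the sum over the ordered partitions     *)
(* (B_1,...,B_r) of the set of labels, with #|B_k| = i_k, of the module       *)
(* RT(B_1) (x) ... (x) RT(B_r), where RT(B) is spanned by the trees with      *)
(* vertex set B. No block is empty, as RT(0) = 0.                             *)
Record boxpow (r n : nat) := BoxPow {
  box_tree :> {ffun 'I_r -> ltree 'I_n};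
  _ : [forall i, #|[set k | i \in vertices (box_tree k)]| == 1] }.
HB.instance Definition _ r n := [isSub for @box_tree r n].
HB.instance Definition _ r n := [Finite of boxpow r n by <:].

Lemma boxpowP r n (u : boxpow r n) (i : 'I_n) :
  exists k, forall l, (i \in vertices (u l)) = (l == k).
Proof.
case: u => u /= /forallP /(_ i) /cards1P[k /setP uk].
by exists k => l; have := uk l; rewrite !inE.
Qed.

Lemma is_boxpow r n (u : {ffun 'I_r -> ltree 'I_n}) :
  (forall i, exists k, forall l, (i \in vertices (u l)) = (l == k)) ->
  [forall i, #|[set k | i \in vertices (u k)]| == 1].
Proof.
move=> h; apply/forallP => i; apply/cards1P; have [k hk] := h i.
by exists k; apply/setP => l; rewrite !inE.
Qed.

Lemma box_act_subproof r n (s : 'S_n) (u : boxpow r n) :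
  let v := [ffun k => relabel (@perm_inj _ s) (u k)] in
  [forall i, #|[set k | i \in vertices (v k)]| == 1].
Proof.
apply: is_boxpow => i; have [k hk] := boxpowP u (s^-1%g i).
exists k => l; rewrite ffunE vertices_relabel -hk.
by rewrite -(mem_imset _ (s^-1%g i) (@perm_inj _ s)) permKV.
Qed.

Definition box_act r n (s : 'S_n) (u : boxpow r n) : boxpow r n :=
  BoxPow (box_act_subproof s u).

Lemma box_perm_subproof r n (s : 'S_r) (u : boxpow r n) :
  let v := [ffun k => u (s^-1%g k)] in
  [forall i, #|[set k | i \in vertices (v k)]| == 1].
Proof.
apply: is_boxpow => i; have [k hk] := boxpowP u i.
by exists (s k) => l; rewrite ffunE hk -(inj_eq (@perm_inj _ s)) permKV.
Qed.

Definition box_perm r n (s : 'S_r) (u : boxpow r n) : boxpow r n :=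
  BoxPow (box_perm_subproof s u).

(* Operadic composition of t with the trees u_1, ..., u_r. The labels of t    *)
(* and those of the u_k are made disjoint in the sum type 'I_r + 'I_n, and    *)
(* the vertices of t are then substituted one after the other.                *)
Section Composition.
Variable K : comPzRingType.

Definition inl_inj' r n : injective (@inl 'I_r 'I_n) :=
  fun a b e => let: erefl := e in erefl.
Definition inr_inj' r n : injective (@inr 'I_r 'I_n) :=
  fun a b e => let: erefl := e in erefl.

Definition comp_sum r n (t : RT r) (u : boxpow r n) :
    freemod K (ltree ('I_r + 'I_n)%type) :=
  foldl (fun g k =>
           lin_ext (fun w => pcomp K w (inl k) (relabel (@inr_inj' r n) (u k))) g)
        (fm_elt (relabel (@inl_inj' r n) t)) (enum 'I_r).

Definition op_comp r n (t : RT r) (u : boxpow r n) : freemod K (RT n) :=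
  \sum_(w : RT n) (comp_sum t u)@_(relabel (@inr_inj' r n) w) *: fm_elt w.

End Composition.

(* ------------------------------------------------------------------------ *)

(* V is the free module K[X]. Hence (+)_n RT(n) (x) V^{(x)n} is the free      *)
(* module on the set of the decorated trees t (x) x_1 (x) ... (x) x_n, and    *)
(* Gamma(RT,V) is the submodule of its invariants.                            *)
Definition dtree (X : choiceType) : choiceType :=
  {n : nat & (RT n * n.-tuple X)%type}.

Section Gamma.
Variable X : choiceType.

Definition mk_dtree n (t : RT n) (x : n.-tuple X) : dtree X :=
  Tagged (fun n => (RT n * n.-tuple X)%type) (t, x).

Definition dtree_act (b : dtree X) (s : 'S_(tag b)) : dtree X :=
  mk_dtree (rt_act s (tagged b).1) (word_act s (tagged b).2).

Definition same_orbit (b c : dtree X) : bool := [exists s, dtree_act (b := b) s == c].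

Lemma rt_act1 n (t : RT n) : rt_act 1 t = t.
Proof.
apply/val_inj/val_inj; case: t => -[[A p] tP] /= AT.
rewrite /relabel_val /vertices /out /=; congr (_, _).
  by rewrite (eq_imset _ (@perm1 _)) imset_id.
apply/ffunP => i; rewrite ffunE; case: pickP => [j /eqP|/(_ i)]; rewrite perm1 ?eqxx //.
by move=> ->; case: (p i) => //= k; rewrite perm1.
Qed.

Lemma rt_actM n (s s' : 'S_n) (t : RT n) : rt_act (s * s')%g t = rt_act s' (rt_act s t).
Proof.
apply/val_inj/val_inj; rewrite /= /relabel_val; congr (_, _).
  by rewrite !vertices_relabel -imset_comp; apply: eq_imset => i; rewrite permM.
apply/ffunP => i; rewrite -[i](permKV (s * s')%g).
set j := ((s * s')^-1)%g i.
have := relabel_outE (@perm_inj _ (s * s')%g) t j; rewrite /= => ->.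
rewrite permM.
have := relabel_outE (@perm_inj _ s') (rt_act s t) (s j); rewrite /= => ->.
have /= -> := relabel_outE (@perm_inj _ s) t j.
by case: (out t j) => //= k; rewrite permM.
Qed.

Lemma word_act1 n (x : n.-tuple X) : word_act 1 x = x.
Proof. by apply: eq_from_tnth => i; rewrite tnth_mktuple invg1 perm1. Qed.

Lemma word_actM n (s s' : 'S_n) (x : n.-tuple X) :
  word_act (s * s')%g x = word_act s' (word_act s x).
Proof. by apply: eq_from_tnth => i; rewrite !tnth_mktuple invMg permM. Qed.

Lemma same_orbitP n (t : RT n) x (c : dtree X) :
  reflect (exists s : 'S_n, c = mk_dtree (rt_act s t) (word_act s x))
          (same_orbit (mk_dtree t x) c).
Proof.
apply: (iffP existsP) => [[s /eqP <-]|[s ->]]; first by exists s.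
by exists s.
Qed.

Lemma same_orbit_equiv : equiv_class_of same_orbit.
Proof.
apply: EquivClass.
- by move=> [n [t x]]; apply/same_orbitP; exists 1%g; rewrite rt_act1 word_act1.
- have sy b c : same_orbit b c -> same_orbit c b.
    case: b => n [t x] /same_orbitP[s ->]; apply/same_orbitP; exists s^-1%g.
    by rewrite -rt_actM -word_actM mulgV rt_act1 word_act1.
  by move=> b c; apply/idP/idP => /sy.
- move=> c b d; case: b => n [t x] /same_orbitP[s ->] /same_orbitP[s' ->].
  by apply/same_orbitP; exists (s * s')%g; rewrite rt_actM word_actM.
Qed.

Canonical same_orbit_rel := EquivRelPack same_orbit_equiv.

(* The basis S(RT,V) of classes t(x_1,...,x_n). *)
Definition dclass := {eq_quot same_orbit}.
HB.instance Definition _ := Choice.on dclass.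
HB.instance Definition _ := EqQuotient.on dclass.

(* The distinct elements of the orbit. *)
Definition orbit_seq (b : dtree X) : seq (dtree X) :=
  undup [seq dtree_act (b := b) s | s : 'S_(tag b)].

Variable K : comPzRingType.

Definition orbit_sum (c : dclass) : freemod K (dtree X) :=
  \sum_(b <- orbit_seq (repr c)) fm_elt b.

Definition Gamma (g : freemod K (dtree X)) : Prop :=
  forall n (s : 'S_n) (t : RT n) (x : n.-tuple X),
    g@_(mk_dtree (rt_act s t) (word_act s x)) = g@_(mk_dtree t x).

Lemma same_orbit_pi (b c : dtree X) : same_orbit b c -> \pi_dclass b = \pi_dclass c.
Proof. by move=> bc; apply/(@eqquotP _ _ dclass); exact: bc. Qed.

Lemma orbit_sumE (c : dclass) (b : dtree X) :
  (orbit_sum c)@_b = (\pi_dclass b == c)%:R.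
Proof.
rewrite /orbit_sum fm_coeff_sum.
under eq_bigr => b' _ do rewrite fm_coeff_elt.
have -> : (\pi_dclass b == c) = (b \in orbit_seq (repr c)).
  rewrite mem_undup -{1}[c]reprK eq_sym eqquotE; apply/idP/mapP => /=.
    by move=> /existsP[s /eqP <-]; exists s; rewrite ?mem_enum.
  by move=> [s _ ->]; apply/existsP; exists s.
have [bo|bo] := boolP (b \in _).
  rewrite (bigD1_seq b) ?undup_uniq //= eqxx big1 ?addr0 // => b' /negbTE -> //.
by rewrite big_seq big1 // => b' b'o; case: eqP => // e; rewrite -e b'o in bo.
Qed.

Lemma lin_ext_orbit_sumE (g : freemod K dclass) (b : dtree X) :
  (lin_ext orbit_sum g)@_b = g@_(\pi_dclass b).
Proof.
rewrite /lin_ext fm_coeff_sum; under eq_bigr => c _ do rewrite fm_coeffZ orbit_sumE.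
set c0 := \pi_dclass b; have [c0g|c0g] := boolP (c0 \in msupp g).
  rewrite (big_fsetD1 c0) //= eqxx mulr1 big_seq big1 ?addr0 // => c.
  by rewrite in_fsetD1 eq_sym => /andP[/negbTE -> _]; rewrite mulr0.
rewrite (mcoeff_outdom c0g) big_seq big1 // => c cg.
by case: eqP => [e|_]; rewrite ?mulr0 //; rewrite e cg in c0g.
Qed.

Lemma orbit_sum_basis : is_basis_of Gamma orbit_sum.
Proof.
split=> [c|g g0|v vG].
- move=> n s t x; rewrite !orbit_sumE; congr (_ == c)%:R.
  by apply/esym/same_orbit_pi/same_orbitP; exists s.
- apply/malgP => c; rewrite -[c]reprK -lin_ext_orbit_sumE g0.
  by rewrite !mcoeff0.
pose g : freemod K dclass :=
  [malg c in [fset \pi_dclass b | b in msupp v]%fset => v@_(repr c)].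
exists g; apply/malgP => b; rewrite lin_ext_orbit_sumE mcoeffE.
have vb b' : \pi_dclass b' = \pi_dclass b -> v@_b' = v@_b.
  move=> /(@eqquotP _ _ dclass) /=; case: b' => n [t x] /same_orbitP[s ->].
  by rewrite vG.
case: ifP => [_|/negbT bv]; first by rewrite vb // reprK.
apply/mcoeff_outdom; apply: contra bv => bv.
by apply/imfsetP; exists b.
Qed.

End Gamma.

(* ------------------------------------------------------------------------ *)

Section Multiplication.
Variables (K : comPzRingType) (X : choiceType).

(* The basis of (+)_r (+)_n RT(r) (x) RT^{[x]r}(n) (x) V^{(x)n}. *)
Definition dforest : choiceType :=
  {r : nat & {n : nat & (RT r * boxpow r n * n.-tuple X)%type}}.

Definition mk_dforest r n (t : RT r) (u : boxpow r n) (x : n.-tuple X) : dforest :=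
  Tagged (fun r => {n : nat & (RT r * boxpow r n * n.-tuple X)%type})
    (Tagged (fun n => (RT r * boxpow r n * n.-tuple X)%type) (t, u, x)).

(* The action of S_r, r = tag y. *)
Definition dforest_act (y : dforest) (s : 'S_(tag y)) : dforest :=
  let: (t, u, x) := tagged (tagged y) in mk_dforest (rt_act s t) (box_perm s u) x.

Definition shuffle r (m : 'I_r -> nat) (s : 'S_(\sum_k m k)) : bool :=
  [forall k, forall i : 'I_(m k), forall j : 'I_(m k),
     (i < j) ==> (s (tagnat.Rank k i) < s (tagnat.Rank k j))]%N.

Lemma Rank_inj r (m : 'I_r -> nat) k : injective (@tagnat.Rank r m k).
Proof.
move=> i j /(congr1 val)/eqP; rewrite tagnat.eq_Rank eqxx /= => /eqP; exact: val_inj.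
Qed.

Lemma juxtapose_subproof r (b : 'I_r -> dtree X) :
  let v := [ffun k => relabel (@Rank_inj r (fun k => tag (b k)) k) (tagged (b k)).1] in
  [forall i, #|[set k | i \in vertices (v k)]| == 1].
Proof.
apply: is_boxpow => i; exists (tagnat.sig1 i) => l; rewrite ffunE vertices_relabel.
rewrite vertices_RT; apply/imsetP/eqP => [[j _ ->]|->]; first by rewrite tagnat.Rank1K.
by exists (tagnat.sig2 i); rewrite ?tagnat.sig2K.
Qed.

(* b_1, ..., b_r put side by side: the labels of b_k are shifted by           *)
(* n_1 + ... + n_(k-1), and the letters are concatenated.                     *)
Definition juxtapose r (b : 'I_r -> dtree X) : boxpow r (\sum_k tag (b k)) :=
  BoxPow (juxtapose_subproof b).

Definition concat r (b : 'I_r -> dtree X) : (\sum_k tag (b k)).-tuple X :=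
  [tuple tnth (tagged (b (tagnat.sig1 i))).2 (tagnat.sig2 i)
     | i < (\sum_k tag (b k))%N].

(* The image of t (x) g_1 (x) ... (x) g_r, where g_k is invariant under       *)
(* S_(n_k), in the invariants of RT(r) (x) RT^{[x]r}(n) (x) V^{(x)n} under    *)
(* S_n, n = n_1 + ... + n_r, is the sum of its translates by the              *)
(* representatives of S_n / (S_(n_1) x ... x S_(n_r)), that is, by the        *)
(* shuffles. This is its value on basis elements, b_k for g_k.                *)
Definition box_sum r (t : RT r) (b : 'I_r -> dtree X) : freemod K dforest :=
  \sum_(s : 'S_(\sum_k tag (b k)) | shuffle s)
     fm_elt (mk_dforest t (box_act s (juxtapose b)) (word_act s (concat b))).

(* Gamma(RT,W), for W = Gamma(RT,V) with its basis of orbit sums O t, is      *)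
(* a submodule of the free module on dtree (dclass X); the letters O t are    *)
(* expanded here.                                                             *)
Definition expand (w : dtree (dclass X)) : freemod K dforest :=
  let: (t, c) := tagged w in
  \sum_(b : {dffun forall k : 'I_(tag w), seq_sub (orbit_seq (repr (tnth c k)))})
     box_sum t (fun k => ssval (b k)).

Definition trace (g : freemod K dforest) : freemod K dforest :=
  lin_ext (fun y => \sum_(s : 'S_(tag y)) fm_elt (dforest_act (y := y) s)) g.

Definition orbit_repr (y : dforest) : dforest :=
  choose (fun z => [exists s, dforest_act (y := y) s == z]) y.

(* The inverse of the trace: as S_r acts freely, an invariant g is the trace  *)
(* of the (class of the) sum of g@_y y over representatives y of the orbits.  *)
Definition trace_inv (g : freemod K dforest) : freemod K dforest :=
  \sum_(y <- msupp g | y == orbit_repr y) g@_y *: fm_elt y.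

Lemma dforest_act1 r n (t : RT r) (u : boxpow r n) x :
  dforest_act (y := mk_dforest t u x) 1%g = mk_dforest t u x.
Proof.
rewrite /dforest_act /= rt_act1; congr mk_dforest.
by apply/val_inj/ffunP => k; rewrite ffunE invg1 perm1.
Qed.

Lemma dforest_actM r n (t : RT r) (u : boxpow r n) x (s s' : 'S_r) :
  dforest_act (y := mk_dforest t u x) (s * s')%g
    = dforest_act (y := mk_dforest (rt_act s t) (box_perm s u) x) s'.
Proof.
rewrite /dforest_act /= rt_actM; congr mk_dforest.
by apply/val_inj/ffunP => k; rewrite !ffunE invMg permM.
Qed.

Lemma box_perm_free r n (u : boxpow r n) (s s' : 'S_r) :
  box_perm s u = box_perm s' u -> s = s'.
Proof.
move=> /(congr1 val)/ffunP /= e; suff : (s^-1 = s'^-1)%g by apply: invg_inj.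
apply/permP => k; have := e k; rewrite !ffunE.
set a := (s^-1)%g k; set a' := (s'^-1)%g k => ua.
have [_ [i [ia _] _]] := ltreeP (u a); have [l hl] := boxpowP u i.
by have := ia; rewrite hl => /eqP ->; move: ia; rewrite ua hl => /eqP ->.
Qed.

Lemma dforest_act_inj (y : dforest) : injective (dforest_act (y := y)).
Proof.
case: y => r [n [[t u] x]] s s'; rewrite /dforest_act /= => e.
have /(congr1 (fun p => p.1.2)) /= := eq_from_Tagged (eq_from_Tagged e).
exact: box_perm_free.
Qed.

Lemma trace_invK (g : freemod K dforest) :
  (forall y s, g@_(dforest_act (y := y) s) = g@_y) -> trace (trace_inv g) = g.
Proof.
move=> ginv; pose orb (y z : dforest) := [exists s, dforest_act (y := y) s == z].
have orbP r n (t : RT r) (u : boxpow r n) x z :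
    reflect (exists s, z = dforest_act (y := mk_dforest t u x) s)
            (orb (mk_dforest t u x) z).
  by apply: (iffP existsP) => [[s /eqP <-]|[s ->]]; exists s.
have orb_refl y : orb y y.
  by case: y => r [n [[t u] x]]; apply/orbP; exists 1%g; rewrite dforest_act1.
have orb_sym y z : orb y z -> orb z y.
  case: y => r [n [[t u] x]] /orbP[s ->]; apply/orbP; exists (s^-1)%g.
  by rewrite -dforest_actM mulgV dforest_act1.
have orb_trans y z w : orb y z -> orb z w -> orb y w.
  case: y => r [n [[t u] x]] /orbP[s ->] /orbP[s' ->]; apply/orbP.
  by exists (s * s')%g; rewrite dforest_actM.
have orb_repr y : orb y (orbit_repr y) by exact: (@chooseP _ (orb y) y).
have orb_eq y z : orb y z -> orbit_repr y = orbit_repr z.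
  move=> yz; rewrite /orbit_repr -/(orb y) -/(orb z).
  have /eq_choose -> : orb y =1 orb z.
    by move=> w; apply/idP/idP; [apply: orb_trans (orb_sym _ _ yz)|apply: orb_trans yz].
  exact: choose_id (orb_sym _ _ yz) (orb_refl z).
apply/malgP => z; rewrite /trace /trace_inv linear_sum /= fm_coeff_sum.
under eq_bigr => y _ do rewrite linearZ /= lin_ext_elt fm_coeffZ fm_coeff_sum.
have count y : \sum_(s : 'S_(tag y)) (fm_elt (dforest_act (y := y) s))@_z
               = (orb y z)%:R :> K.
  under eq_bigr => s _ do rewrite fm_coeff_elt.
  case: (boolP (orb y z)) => [/existsP[s /eqP yz]|yz]; last first.
    apply: big1 => s _; case: eqP => // e; case/negP: yz.
    by apply/existsP; exists s; apply/eqP.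
  rewrite (bigD1 s) //= yz eqxx big1 ?addr0 // => s' s's.
  case: eqP => // e; case/eqP: s's; apply: (@dforest_act_inj y).
  by rewrite e yz.
have gorb y w : orb y w -> g@_w = g@_y by move=> /existsP[s /eqP <-].
under eq_bigr => y _ do rewrite count.
have zz0 := orb_repr z; set z0 := orbit_repr z in zz0.
have z0z := orb_sym _ _ zz0.
have z0r : z0 == orbit_repr z0 by rewrite -(orb_eq _ _ zz0).
have uniq_z0 y : y == orbit_repr y -> orb y z -> y = z0.
  by move=> /eqP yr yz; rewrite yr (orb_eq _ _ yz).
rewrite big_mkcond /=.
have term0 y : y != z0 ->
    (if y == orbit_repr y then g@_y * (orb y z)%:R else 0 : K) = 0.
  move=> yz0; case: ifP => // yr; case: (boolP (orb y z)) => [yz|_].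
    by case/eqP: yz0; apply: uniq_z0.
  by rewrite mulr0.
case: (boolP (z0 \in msupp g)) => zg.
  rewrite (big_fsetD1 z0) //= z0r z0z mulr1 -(gorb _ _ z0z) big_seq big1 ?addr0 // => y.
  by rewrite in_fsetD1 => /andP[/term0 ->].
rewrite (gorb _ _ z0z) (mcoeff_outdom zg) big_seq big1 // => y yg.
by apply: term0; apply: contraTneq yg => ->.
Qed.

Definition compose (y : dforest) : freemod K (dtree X) :=
  let: (t, u, x) := tagged (tagged y) in
  lin_ext (fun w => fm_elt (mk_dtree w x)) (op_comp K t u).

Definition mu_tilde (w : freemod K (dtree (dclass X))) : freemod K (dtree X) :=
  lin_ext compose (trace_inv (lin_ext expand w)).

End Multiplication.

(* ------------------------------------------------------------------------ *)

Section NormalForm.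
Variable X : choiceType.

Inductive monomial : Type := Monomial (x : X) (r : nat) (M : 'I_r -> monomial).

(* Equality up to permutation of the non-root entries, at all levels. *)
Inductive mono_eq : monomial -> monomial -> Prop :=
  MonoEq x r (M N : 'I_r -> monomial) (s : 'S_r) :
    (forall i, mono_eq (M i) (N (s i))) -> mono_eq (Monomial x M) (Monomial x N).

HB.instance Definition _ := gen_eqMixin monomial.
HB.instance Definition _ := gen_choiceMixin monomial.

Lemma mono_eq_equiv : equiv_class_of (fun M N => `[< mono_eq M N >]).
Proof.
have refl M : mono_eq M M.
  by elim: M => x r M IH; apply: (@MonoEq _ _ _ _ 1%g) => i; rewrite perm1.
have sym M N : mono_eq M N -> mono_eq N M.
  elim=> x r {}M {}N s _ IH; apply: (@MonoEq _ _ _ _ s^-1%g) => i.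
  by have := IH (s^-1%g i); rewrite permKV.
have trans M N P : mono_eq M N -> mono_eq N P -> mono_eq M P.
  move=> MN; elim: MN P => x r {}M {}N s _ IH P NP.
  inversion NP as [y r' N' P' s' h [e1 e2 eN]].
  have {}eN := eq_from_Tagged eN; rewrite eN in h.
  by apply: (@MonoEq _ _ _ _ (s * s')%g) => i; rewrite permM; apply: IH.
apply: EquivClass.
- by move=> M; apply/asboolP.
- by move=> M N; apply/asboolP/asboolP => /sym.
- by move=> N M P /asboolP MN /asboolP NP; apply/asboolP/trans/NP.
Qed.

Canonical mono_eq_rel := EquivRelPack mono_eq_equiv.

Definition nf_monomial := {eq_quot mono_eq_rel}.
HB.instance Definition _ := Choice.on nf_monomial.
HB.instance Definition _ := EqQuotient.on nf_monomial.

Definition single (x : X) : dclass X := \pi_(dclass X) (mk_dtree (corolla 0) [tuple x]).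

Variable K : comPzRingType.

(* O F_r(x,c_1,...,c_r), for x in X and c_k in the basis of Gamma(RT,V). *)
Definition corolla_sum (x : X) r (c : 'I_r -> dclass X) :
    freemod K (dtree (dclass X)) :=
  orbit_sum K (\pi_(dclass (dclass X)) (mk_dtree (corolla r)
    [tuple of single x :: [tuple c k | k < r]])).

(* The t such that g = O t; the default value is irrelevant, as every value   *)
(* of ev below is an orbit sum.                                               *)
Definition orbit_class (x : X) (g : freemod K (dtree X)) : dclass X :=
  classical_sets.xget (single x) (fun t => orbit_sum K t = g).

Fixpoint ev (m : monomial) : freemod K (dtree X) :=
  let: Monomial x r M := m in
  mu_tilde (corolla_sum x (fun k => orbit_class x (ev (M k)))).

End NormalForm.

(* Main.v *)
Require Import Defs.
From mathcomp Require Import all_boot all_order all_algebra.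
From mathcomp Require Import all_fingroup finmap monalg zify boolp.
From mathcomp Require Import generic_quotient.


(** A decorated rooted tree is determined, up to relabelling, by the decoration
    of its root and the multiset of the decorated trees hanging from the root.
    Applied recursively, this attaches to each decorated tree a monomial, its
    shape, which is unique up to permutation of the non-root entries
    ([has_shape_uniq]); two trees with the same shape lie in the same orbit
    ([same_shape_orbit]), and each monomial is a shape ([has_shape_onto]). So
    orbits of decorated trees are in bijection with the monomials up to
    [mono_eq]. As the orbit sums form a basis of the invariants, everything
    follows from the formula [ev_coeff]: the coefficient of [ev M] at a
    decorated tree [b] is 1 if [b] has shape [M], and 0 otherwise.

    By induction on [M], the formula amounts to computing a coefficient of
    [mu_tilde G] at a tree [w], where [G] is O F_r(x, c_1, ..., c_r). Three
    facts carry the computation.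

    - A forest is a tree of the operad with one block for each of its vertices.
      The coefficient of the expansion of [G] at a forest is the coefficient of [G] at
      the tree obtained by replacing each block by its orbit
      ([expand_collapse]): a forest comes from one choice of standardized
      blocks and from one shuffle only.

    - Consider the forests over a corolla whose root block is a single vertex.
      Such a forest composes to a single tree ([compose_corolla]), because each
      vertex that gets substituted has no incoming edge, unless it is the root,
      whose incoming edges have one vertex to be attached to. Moreover, the
      forests that compose to [w] form one free orbit of the symmetric group
      ([grafts_perm]), that of the forest [y0] obtained by cutting the edges of
      [w] that enter its root ([decompose]).

    - Hence the coefficient of [compose y] at [w] is that of the trace of [y] at
      [y0] ([compose_trace]). Summing over the forests [y] in [trace_inv g], for
      [g] the expansion of [G], the coefficient of [mu_tilde G] at [w] is that
      of [trace (trace_inv g) = g] at [y0] ([mu_tilde_coeff]). The orbit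
      representatives chosen by [trace_inv] have disappeared, and nothing has
      been divided by r!, so that the result holds over any ring.

    The coefficient is therefore that of [G] at the collapse of [y0], namely 1
    exactly when the branches of [w] belong to the orbits c_1, ..., c_r in some
    order and its root is decorated by x ([mu_tilde_corolla]). *)

Set Implicit Arguments.
Unset Strict Implicit.
Unset Printing Implicit Defensive.

Import GRing.Theory.
Local Open Scope ring_scope.
Local Open Scope quotient_scope.

(** * Shapes of decorated trees *)

Section Shape.
Variable X : choiceType.

(** For a parent map [p] and a decoration [z], the branch above [i] has shape
    [M]. The enumeration [c] of the children is existentially quantified, which
    builds invariance under permutation of the entries into the definition. *)
Fixpoint shape (T : finType) (p : T -> option T) (z : T -> X) (i : T)
    (M : monomial X) : Prop :=
  let: Monomial x r Ms := M in
  z i = x /\ exists c : 'I_r -> T,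
    [/\ injective c, forall j, p j = Some i <-> exists k, j = c k
      & forall k, shape p z (c k) (Ms k)].

(** Two enumerations of the children of a vertex differ by a permutation. *)
Lemma shape_uniq (T : finType) (p : T -> option T) z i (M N : monomial X) :
  shape p z i M -> shape p z i N -> mono_eq M N.
Proof.
elim: M i N => x r M IH i [y r' N] /= [<- [c [c_inj cP cM]]] [<- [d [d_inj dP dN]]].
have cd k : exists l, c k = d l by apply/dP/cP; exists k.
have dc l : exists k, d l = c k by apply/cP/dP; exists l.
have [f fP] := boolp.choice cd; have [g gP] := boolp.choice dc.
have f_inj : injective f by move=> k l e; apply: c_inj; rewrite !fP e.
have g_inj : injective g by move=> k l e; apply: d_inj; rewrite !gP e.
have rr' : r = r'.
  have := leq_card _ f_inj; have := leq_card _ g_inj; rewrite !card_ord => gle fle.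
  by apply/eqP; rewrite eqn_leq fle gle.
subst r'; apply: (@MonoEq _ _ _ _ _ (perm f_inj)) => k; rewrite permE.
by apply: (IH k (c k)) => //; rewrite fP.
Qed.

Lemma shape_mono_eq (T : finType) (p : T -> option T) z i (M N : monomial X) :
  mono_eq M N -> shape p z i M -> shape p z i N.
Proof.
move=> MN; elim: MN i => x r {}M {}N s _ IH i /= [<- [c [c_inj cP cM]]].
split=> //; exists (fun k => c (s^-1%g k)); split.
- by move=> k l /c_inj/perm_inj.
- move=> j; rewrite cP; split=> -[k ->]; last by exists (s^-1%g k).
  by exists (s k); rewrite permK.
by move=> k; rewrite -{2}[k](permKV s); apply/IH/cM.
Qed.

(** Transport of shapes along a map which, on the set [D] closed under taking
    children, induces bijections between sets of children. Restricting to [D]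
    is what allows comparing a tree with one of its branches. *)
Lemma shape_morph (S T : finType) (p : S -> option S) (q : T -> option T)
    (z : S -> X) (z' : T -> X) (h : S -> T) (D : S -> Prop) :
  injective h ->
  (forall a, D a -> z' (h a) = z a) ->
  (forall a b, D a -> p b = Some a -> D b /\ q (h b) = Some (h a)) ->
  (forall a j, D a -> q j = Some (h a) -> exists2 b, p b = Some a & j = h b) ->
  forall i M, D i -> shape p z i M -> shape q z' (h i) M.
Proof.
move=> h_inj hz hp hq i M; elim: M i => x r M IH i Di /= [<- [c [c_inj cP cM]]].
have ci k : p (c k) = Some i by apply/cP; exists k.
split; first exact: hz.
exists (h \o c); split; first exact: inj_comp.
- move=> j; split=> [/hq[]// b /cP[k ->] ->|[k ->]]; first by exists k.
  by have [] := hp _ _ Di (ci k).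
by move=> k; apply: IH => //; have [] := hp _ _ Di (ci k).
Qed.

(** Abstract form of the distance to the root, which expresses that the parent
    map has no cycles without naming a root. *)
Definition graded (T : finType) (p : T -> option T) (d : T -> nat) : Prop :=
  forall a b, p a = Some b -> d a = (d b).+1.

Lemma ltree_graded (T : finType) (t : ltree T) : exists d, graded (out t) d.
Proof.
pose up m a := iter m (obind (out t)) (Some a).
have upS m a : up m.+1 a = if out t a is Some b then up m b else None.
  rewrite /up iterSr /=; case: (out t a) => //.
  by elim: m => //= m ->.
have [_ [r [_ rN] rc]] := ltreeP t.
have ex a : exists m, a \in vertices t -> up m a = Some r.
  case: (boolP (a \in vertices t)) => [/rc/connectP[s ps ->]|_]; last by exists 0.
  exists (size s) => _.
  elim: s a ps => [|b s IH] a // /andP[/eqP ab /IH].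
  by rewrite [size _]/= upS ab.
have [d dP] := boolp.choice ex; exists d => a b ab.
have up_uniq m m' c : up m c = Some r -> up m' c = Some r -> m = m'.
  elim: m m' c => [|m IH] [|m'] c //.
  - by move=> [->]; rewrite upS rN.
  - by rewrite upS => h [e]; move: h; rewrite e rN.
  by rewrite !upS; case: (out t c) => // c' /IH h /h ->.
have [at_ bt] := out_vertices ab.
by apply: (up_uniq _ _ a (dP a at_)); rewrite upS ab dP.
Qed.

(** Well-founded recursion towards the leaves: [d] increases and is bounded. *)
Lemma shape_exists (T : finType) (p : T -> option T) (z : T -> X) d i :
  graded p d -> exists M, shape p z i M.
Proof.
move=> dP; have [m] := ubnP (\max_j d j - d i)%N; elim: m i => // m IH i im.
set A := [set j | p j == Some i].
have ex (k : 'I_#|A|) : exists M, shape p z (enum_val k) M.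
  apply: IH; have := enum_valP k; rewrite inE => /eqP/dP dk.
  have : (d (enum_val k) <= \max_j d j)%N by rewrite leq_bigmax.
  by rewrite dk in im *; lia.
have [M MP] := boolp.choice ex; exists (Monomial (z i) M); split=> //.
exists enum_val; split=> // [|j]; first exact: enum_val_inj.
split=> [ji|[k ->]]; last by have := enum_valP k; rewrite inE => /eqP.
have jA : j \in A by rewrite inE ji.
by exists (enum_rank_in jA j); rewrite enum_rankK_in.
Qed.

End Shape.

Section LTreeExtra.
Variable T : finType.
Implicit Types t u : ltree T.

Lemma ltree_eq t u : vertices t = vertices u -> out t =1 out u -> t = u.
Proof.
move=> vtu /ffunP otu; apply/val_inj.
by rewrite /= [LHS]surjective_pairing [RHS]surjective_pairing; congr (_, _).
Qed.

Lemma out_relabel (S : finType) (h : T -> S) (h_inj : injective h) t j :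
  out (relabel h_inj t) (h j) = omap h (out t j).
Proof. exact: relabel_outE. Qed.

Lemma relabel_out (S : finType) (h : T -> S) (h_inj : injective h) t i j :
  out (relabel h_inj t) i = Some j ->
  exists a b, [/\ i = h a, j = h b & out t a = Some b].
Proof.
move=> ij; have [+ _] := out_vertices ij; rewrite vertices_relabel.
move=> /imsetP[a _ ia]; move: ij; rewrite ia out_relabel.
by case ab: (out t a) => [b|] //= [<-]; exists a, b.
Qed.

Lemma ltree_root_connect t i j :
  i \in vertices t -> out t i = None -> j \in vertices t ->
  connect [rel a b | out t a == Some b] j i.
Proof.
move=> it iN jt; have [_ [r [_ rN] rc]] := ltreeP t.
have /connectP[[|k p] /=] := rc i it; last by rewrite iN.
by move=> _ <-; apply: rc.
Qed.

Lemma ltree_root_uniq t i j : i \in vertices t -> out t i = None ->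
  j \in vertices t -> out t j = None -> j = i.
Proof.
move=> it iN jt jN; have /connectP[[|k p] /=] := ltree_root_connect it iN jt => //.
by rewrite jN.
Qed.

Lemma ltree_root t : exists2 i, i \in vertices t & out t i = None.
Proof. by have [_ [r [rt rN] _]] := ltreeP t; exists r. Qed.

End LTreeExtra.

Lemma RT_eq n (t u : RT n) : out t =1 out u -> t = u.
Proof. by move=> tu; apply/val_inj/ltree_eq; rewrite ?vertices_RT. Qed.

(** * Positions in a monomial *)

Section Positions.
Variable X : choiceType.

(** The positions in [M]: the vertices of the tree that [M] describes. They
    provide both a tree of shape [M] and coordinates on any such tree. *)
Fixpoint pos (M : monomial X) : finType :=
  let: Monomial x r Ms := M in option {k : 'I_r & pos (Ms k)}.

Definition pos_root (M : monomial X) : pos M :=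
  match M with Monomial _ _ _ => None end.

Definition pos_sub (r : nat) (Ms : 'I_r -> monomial X) k (a : pos (Ms k)) :
  option {k : 'I_r & pos (Ms k)} := Some (Tagged (fun k => pos (Ms k)) a).

Fixpoint pos_parent (M : monomial X) : pos M -> option (pos M) :=
  match M with Monomial x r Ms => fun a =>
    if a is Some (existT k b) then
      Some (obind (fun b' => pos_sub b') (pos_parent b))
    else None
  end.

Fixpoint pos_label (M : monomial X) : pos M -> X :=
  match M with Monomial x r Ms => fun a =>
    if a is Some (existT k b) then pos_label b else x
  end.

Lemma pos_sub_inj r (Ms : 'I_r -> monomial X) k : injective (@pos_sub r Ms k).
Proof.
move=> a b /(congr1 (odflt (Tagged (fun k => pos (Ms k)) a))).
exact: eq_from_Tagged.
Qed.

Lemma pos_sub_tag r (Ms : 'I_r -> monomial X) k l (a : pos (Ms k)) (b : pos (Ms l)) :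
  pos_sub a = pos_sub b -> k = l.
Proof. by move=> /(congr1 (omap tag)) []. Qed.

Lemma pos_parent_root (M : monomial X) (a : pos M) : pos_parent a = None <-> a = pos_root M.
Proof. by case: M a => x r Ms [[k b]|]. Qed.

Lemma pos_shape (M : monomial X) : shape (@pos_parent M) (@pos_label M) (pos_root M) M.
Proof.
elim: M => x r Ms IH /=; split=> //.
exists (fun k => pos_sub (pos_root (Ms k))); split.
- by move=> k l /pos_sub_tag.
- move=> [[k b]|] /=; last by split=> // -[].
  split=> [[]|[l e]]; last first.
    have kl := pos_sub_tag e; subst l; have /= -> := pos_sub_inj e.
    by rewrite (pos_parent_root _).2.
  case e: (pos_parent b) => [b0|] // _; exists k; congr (Some _).
  by have /pos_parent_root -> := e.
move=> k; apply: (@shape_morph _ _ _ (@pos_parent (Ms k)) _ (@pos_label (Ms k)) _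
  (@pos_sub r Ms k) (fun=> True)) => //.
- exact: pos_sub_inj.
- by move=> a b _ /= ->.
move=> a [[l b]|] //= _ []; case e: (pos_parent b) => [b'|] //= ba.
have lk := pos_sub_tag ba; subst l; exists b => //.
by rewrite e (pos_sub_inj ba).
Qed.

Lemma pos_is_ltree (M : monomial X) : is_ltree ([set: pos M], [ffun a => pos_parent a]).
Proof.
apply: is_ltreeP => [a|]; first by rewrite inE.
exists (pos_root M); first by rewrite inE ffunE (pos_parent_root _).2.
move=> a _; have : connect [rel a b | pos_parent a == Some b] a (pos_root M).
  elim: M a => x r Ms IH [[k b]|] /=; last exact: connect0.
  apply: (@connect_trans _ _ (pos_sub (pos_root (Ms k)))); last first.
    by apply: connect1; rewrite /= (pos_parent_root _).2.
  by apply: omap_out_connect (IH k b) => a' b' /= ->.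
by apply: (@omap_out_connect _ _ id) => a' b'; rewrite ffunE.
Qed.

Definition pos_ltree (M : monomial X) : ltree (pos M) := LTree (pos_is_ltree M).

Lemma graded_iter (T : finType) (p : T -> option T) d m a b : graded p d ->
  iter m (obind p) (Some a) = Some b -> d a = (d b + m)%N.
Proof.
move=> dP; elim: m a b => [|m IH] a b; first by move=> [->]; rewrite addn0.
rewrite iterS; case e: (iter m _ _) => [c|] //= /dP dc.
by rewrite (IH _ _ e) dc addSnnS.
Qed.

(** Gluing of the coordinates on the branches above the children. For the glued
    map to be injective, the branches must be disjoint; the last clause of the
    conclusion serves this purpose within the induction, as two children of [i]
    below a common vertex would be reached in the same number of steps. *)
Lemma pos_embed (T : finType) (p : T -> option T) z d i (M : monomial X) :
  graded p d -> shape p z i M ->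
  exists h : pos M -> T,
    [/\ injective h /\ h (pos_root M) = i,
        forall a b, pos_parent a = Some b -> p (h a) = Some (h b),
        forall a, z (h a) = pos_label a,
        forall a j, p j = Some (h a) -> exists b, j = h b
      & forall a, exists m, iter m (obind p) (Some (h a)) = Some i].
Proof.
move=> dP; elim: M i => x r Ms IH i /= [zi [c [c_inj cP cM]]].
have ci k : p (c k) = Some i by apply/cP; exists k.
have [h hP] := fin_all_exists (fun k => IH k (c k) (cM k)).
exists (fun a => if a is Some (existT k b) then h k b else i).
have di k b : h k b <> i.
  move=> e; have [_ _ _ _ /(_ b)[m]] := hP k; rewrite e => /(graded_iter dP).
  by rewrite (dP _ _ (ci k)); lia.
split.
- split=> // -[[k b]|] [[l b']|] // e; [| by case: (di k b)|by case: (di l b')].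
  have [[hk_inj _] _ _ _ /(_ b)[m hm]] := hP k.
  have [_ _ _ _ /(_ b')[m' hm']] := hP l.
  have mm' : m = m'.
    have := graded_iter dP hm; have := graded_iter dP hm'.
    by rewrite (dP _ _ (ci k)) (dP _ _ (ci l)) e; lia.
  move: hm'; rewrite -mm' -e hm => -[] /c_inj kl; subst l.
  by rewrite (hk_inj _ _ e).
- move=> [[k b]|] //= b' [<-]; have [[_ hr] hp _ _ _] := hP k.
  case e: (pos_parent b) => [b1|] /=; first exact: hp.
  by have /pos_parent_root -> := e; rewrite hr.
- by move=> [[k b]|] //=; have [_ _ -> _ _] := hP k.
- move=> [[k b]|] j.
    have [_ _ _ hc _] := hP k => /hc[b' ->].
    by exists (Some (Tagged (fun k => pos (Ms k)) b')).
  move=> /cP[k ->]; exists (Some (Tagged (fun k => pos (Ms k)) (pos_root (Ms k)))) => /=.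
  by have [[_ ->] _ _ _ _] := hP k.
move=> [[k b]|]; last by exists 0.
have [_ _ _ _ /(_ b)[m hm]] := hP k.
by exists m.+1; rewrite iterS hm /= ci.
Qed.

Definition has_shape (w : dtree X) (M : monomial X) : Prop :=
  let: (t, x) := tagged w in
  exists2 i, out t i = None & shape (out t) (tnth x) i M.

Lemma has_shape_exists (w : dtree X) : exists M, has_shape w M.
Proof.
case: w => n [t x]; have [i _ iN] := ltree_root t; have [d dP] := ltree_graded t.
by have [M MP] := shape_exists (tnth x) i dP; exists M; exists i.
Qed.

Lemma has_shape_uniq (w : dtree X) M N :
  has_shape w M -> has_shape w N <-> mono_eq M N.
Proof.
case: w => n [t x] [i iN iM]; split=> [[j jN jM]|MN]; last first.
  by exists i => //; apply: shape_mono_eq iM.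
have ji : j = i by apply: (ltree_root_uniq _ iN _ jN); rewrite vertices_RT inE.
by rewrite ji in jM; apply: shape_uniq iM jM.
Qed.

Lemma shape_relabel (S T : finType) (h : S -> T) (h_inj : injective h) (t : ltree S)
    (z : S -> X) (z' : T -> X) i M :
  (forall a, z' (h a) = z a) -> shape (out t) z i M ->
  shape (out (relabel h_inj t)) z' (h i) M.
Proof.
move=> zz'; apply: (@shape_morph _ _ _ _ _ _ _ h (fun=> True)) => //.
  by move=> a b _ ba; rewrite out_relabel ba.
by move=> a j _ /relabel_out[b [a' [-> /h_inj <- ba]]]; exists b.
Qed.

Lemma has_shape_orbit (w w' : dtree X) M :
  same_orbit w w' -> has_shape w M -> has_shape w' M.
Proof.
case: w => n [t x] /same_orbitP[s ->] [i iN iM]; exists (s i).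
  by rewrite out_relabel iN.
by apply: shape_relabel iM => a; rewrite tnth_mktuple permK.
Qed.

Lemma has_shape_onto (M : monomial X) : exists w, has_shape w M.
Proof.
pose t := relabel (@enum_rank_inj (pos M)) (pos_ltree M).
have tv : vertices t == [set: 'I_#|pos M|].
  apply/eqP/setP => i; rewrite vertices_relabel inE; apply/imsetP.
  by exists (enum_val i); rewrite ?inE ?enum_valK.
pose x := [tuple pos_label (enum_val i) | i < #|pos M|].
exists (mk_dtree (MkRT tv) x); exists (enum_rank (pos_root M)).
  by rewrite /= out_relabel /out /= ffunE (pos_parent_root _).2.
apply: (@shape_relabel _ _ _ _ _ (@pos_label M)) => [a|].
  by rewrite tnth_mktuple enum_rankK.
have := pos_shape M; congr shape.
by apply/funext => a; rewrite /out /= ffunE.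
Qed.

(** Every vertex is reached from the root through the children, so that the
    embedding of the positions is onto. *)
Lemma pos_bij n (t : RT n) (z : 'I_n -> X) i M :
  out t i = None -> shape (out t) z i M ->
  exists h : pos M -> 'I_n,
    [/\ injective h, forall a, out t (h a) = omap h (pos_parent a),
        forall a, z (h a) = pos_label a & forall j, exists a, h a = j].
Proof.
move=> iN iM; have [d dP] := ltree_graded t.
have [h [[h_inj hr] hp hz hc _]] := pos_embed dP iM; exists h; split=> // [a|j].
  case e: (pos_parent a) => [b|]; first exact: hp.
  by have /pos_parent_root -> := e; rewrite hr.
have : connect [rel a b | out t a == Some b] j i.
  by apply: ltree_root_connect => //; rewrite vertices_RT inE.
move=> /connectP[s]; elim: s j => [|k s IH] j /=; first by move=> _ <-; exists (pos_root M).
move=> /andP[/eqP jk /IH{}IH /IH[a ak]]; rewrite -ak in jk.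
by have [b ->] := hc _ _ jk; exists b.
Qed.

(** Both trees are coordinatized by the positions of [M]; the relabelling is the
    change of coordinates. *)
Lemma same_shape_orbit (w w' : dtree X) M :
  has_shape w M -> has_shape w' M -> same_orbit w w'.
Proof.
case: w w' => n [t x] [n' [t' x']] [i iN iM] [i' iN' iM'].
have [h [h_inj hp hz hs]] := pos_bij iN iM.
have [h' [h_inj' hp' hz' hs']] := pos_bij iN' iM'.
have [g gP] := boolp.choice hs.
have g_inj : injective g by move=> j k e; rewrite -[j]gP e gP.
have [g' gP'] := boolp.choice hs'.
have g_inj' : injective g' by move=> j k e; rewrite -[j]gP' e gP'.
have nn' : n = n'.
  have := leq_card _ (inj_comp h_inj' g_inj); have := leq_card _ (inj_comp h_inj g_inj').
  by rewrite !card_ord => le_n'n le_nn'; apply/eqP; rewrite eqn_leq le_nn'.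
subst n'; pose s := perm (inj_comp h_inj' g_inj).
have sh a : s (h a) = h' a.
  by rewrite permE /=; congr h'; apply: h_inj; rewrite gP.
apply/same_orbitP; exists s; congr mk_dtree.
  apply/RT_eq => j; rewrite -(gP' j) hp' -sh out_relabel hp.
  by case: (pos_parent _) => //= a; rewrite sh.
apply: eq_from_tnth => j; rewrite tnth_mktuple -(gP' j) hz' -sh permK.
by rewrite hz.
Qed.

End Positions.
(** * Expanding the letters of an invariant *)

Section Increasing.

Lemma sorted_enum_ord m : sorted (fun i j : 'I_m => (i < j)%N) (enum 'I_m).
Proof.
have := iota_ltn_sorted 0 m; rewrite -val_enum_ord sorted_map.
exact: sub_sorted.
Qed.

Lemma ord_lt_trans m : transitive (fun i j : 'I_m => (i < j)%N).
Proof. by move=> j i k; apply: ltn_trans. Qed.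

Lemma enum_val_homo n (A : {set 'I_n}) :
  {homo @enum_val _ (mem A) : i j / (i < j)%N}.
Proof.
move=> i j ij; have x0 := enum_val i; rewrite !(enum_val_nth x0).
apply: (sorted_ltn_nth (@ord_lt_trans n) x0 _) => //; rewrite ?inE -?cardE //.
by rewrite /enum_mem -enumT; apply/(sorted_filter (@ord_lt_trans n))/sorted_enum_ord.
Qed.

Lemma increasing_uniq m n (h h' : 'I_m -> 'I_n) :
  {homo h : i j / (i < j)%N} -> {homo h' : i j / (i < j)%N} ->
  [set h i | i : 'I_m] = [set h' i | i : 'I_m] -> h =1 h'.
Proof.
move=> h_incr h'_incr im; suff /eq_in_map e : map h (enum 'I_m) = map h' (enum 'I_m).
  by move=> i; apply: e; rewrite mem_enum.
apply: (irr_sorted_eq (@ord_lt_trans n)).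
- by move=> i; apply: ltnn.
- exact: homo_sorted (sorted_enum_ord m).
- exact: homo_sorted (sorted_enum_ord m).
move=> j; have := congr1 (fun A : {set 'I_n} => j \in A) im.
move=> e; apply/mapP/mapP => -[i _ ji].
  have : j \in [set h i | i : 'I_m] by rewrite ji imset_f.
  by rewrite e => /imsetP[i' _ ->]; exists i'; rewrite ?mem_enum.
have : j \in [set h' i | i : 'I_m] by rewrite ji imset_f.
by rewrite -e => /imsetP[i' _ ->]; exists i'; rewrite ?mem_enum.
Qed.

Lemma increasing_inj m n (h : 'I_m -> 'I_n) : {homo h : i j / (i < j)%N} -> injective h.
Proof.
move=> h_incr i j e; apply/val_inj; case: (ltngtP i j) => // /h_incr.
  by rewrite e ltnn.
by rewrite e ltnn.
Qed.

End Increasing.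

Section Blocks.
Variable X : choiceType.

(** [b] is the standardization of the tree [u] on a subset of the labels, [h]
    being the increasing enumeration of this subset. *)
Definition standard n (b : dtree X) (u : ltree 'I_n) (z : 'I_n -> X)
    (h : 'I_(tag b) -> 'I_n) : Prop :=
  [/\ {homo h : i j / (i < j)%N},
      vertices u = [set h a | a : 'I_(tag b)],
      forall a, out u (h a) = omap h (out (tagged b).1 a)
    & forall a, z (h a) = tnth (tagged b).2 a].

Section Block.
Variables (n : nat) (u : ltree 'I_n) (z : 'I_n -> X).
Let m := #|vertices u|.

Definition block_val : {set 'I_m} * {ffun 'I_m -> option 'I_m} :=
  ([set: 'I_m], [ffun a => obind (fun j => [pick b : 'I_m | enum_val b == j])
                                 (out u (enum_val a))]).

Lemma block_out (a b : 'I_m) :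
  (block_val.2 a == Some b) = (out u (enum_val a) == Some (enum_val b)).
Proof.
rewrite ffunE; case e: (out u _) => [j|] //=.
case: pickP => [c /eqP <-|/(_ b)]; last first.
  by move=> jb; rewrite -[RHS]/(j == enum_val b) [RHS]eq_sym jb.
by rewrite -[RHS]/(enum_val c == enum_val b) (inj_eq enum_val_inj).
Qed.

Lemma block_outN (a : 'I_m) : out u (enum_val a) = None -> block_val.2 a = None.
Proof. by rewrite ffunE => ->. Qed.

Lemma block_is_ltree : is_ltree block_val.
Proof.
apply: is_ltreeP => [a|]; first by rewrite inE.
have [_ [r [ru rN] rc]] := ltreeP u.
exists (enum_rank_in ru r).
  by rewrite inE block_outN // enum_rankK_in.
move=> a _; rewrite -[a](enum_valK_in ru).
apply: omap_out_connect (rc _ (enum_valP a)) => j k jk.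
have [ju ku] := out_vertices jk.
by apply/eqP; rewrite block_out !enum_rankK_in // jk.
Qed.

Lemma block_full : vertices (LTree block_is_ltree) == [set: 'I_m].
Proof. by []. Qed.

Definition block : dtree X :=
  mk_dtree (MkRT block_full) [tuple z (enum_val a) | a < m].

Lemma block_standard : standard u z (enum_val : 'I_(tag block) -> 'I_n).
Proof.
split=> [|||a]; last by rewrite tnth_mktuple.
- exact: enum_val_homo.
- apply/setP => j; apply/idP/imsetP => [ju|[a _ ->]]; last exact: enum_valP.
  by exists (enum_rank_in ju j); rewrite ?enum_rankK_in.
move=> a; case e: (out u (enum_val a)) => [j|].
  have [_ ju] := out_vertices e; pose b : 'I_m := enum_rank_in ju j.
  have bj : enum_val b = j by rewrite enum_rankK_in.
  have /eqP : block_val.2 a == Some b by rewrite block_out bj e.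
  by rewrite /= /out /= => -> /=; rewrite bj.
by have := block_outN e; rewrite /= /out /= => ->.
Qed.

End Block.

(** A finite set of labels has only one increasing enumeration. *)
Lemma standard_uniq n (u : ltree 'I_n) z (b b' : dtree X) h h' :
  @standard n b u z h -> @standard n b' u z h' -> b = b'.
Proof.
case: b b' h h' => m [t x] [m' [t' x']] h h' [] /= hi hv ho hz [] /= hi' hv' ho' hz'.
have mm' : m = m'.
  have := card_imset predT (increasing_inj hi); have := card_imset predT (increasing_inj hi').
  by rewrite -hv -hv' !card_ord => -> ->.
subst m'; have hh' : h = h'.
  by apply/funext/(increasing_uniq hi hi'); rewrite -hv -hv'.
subst h'; congr (mk_dtree _ _).
  apply/RT_eq => a; have := ho a; rewrite ho'.
  by case: (out t a) (out t' a) => [c|] [c'|] //= [] /(increasing_inj hi) ->.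
by apply: eq_from_tnth => a; rewrite -hz hz'.
Qed.

Lemma standard_block n (u : ltree 'I_n) z b h : @standard n b u z h -> b = block u z.
Proof. by move=> bh; apply: standard_uniq bh (block_standard u z). Qed.

(** By definition, a shuffle is increasing on each of the blocks of labels, so
    the blocks of a translate by a shuffle standardize to the original trees. *)
Lemma shuffle_standard r (b : 'I_r -> dtree X) (s : 'S_(\sum_k tag (b k))) k :
  shuffle s ->
  standard (box_act s (juxtapose b) k) (tnth (word_act s (concat b)))
    (fun i : 'I_(tag (b k)) => s (tagnat.Rank k i)).
Proof.
move=> /forallP/(_ k)/forallP sh; split.
- by move=> i j ij; have /forallP/(_ j)/implyP := sh i; apply.
- rewrite ffunE vertices_relabel ffunE vertices_relabel vertices_RT -imset_comp.
  by apply/setP => j; apply/imsetP/imsetP => -[a _ ->]; exists a; rewrite ?inE.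
- move=> i; rewrite ffunE out_relabel ffunE out_relabel -[RHS]/(omap _ _).
  by case: (out _ i).
move=> i; rewrite tnth_mktuple permK tnth_mktuple.
pose F (p : {k & 'I_(tag (b k))}) := tnth (tagged (b (tag p))).2 (tagged p).
exact: (congr1 F (tagnat.rankK _)).
Qed.

Lemma ltree_standard n (u u' : ltree 'I_n) z z' b h :
  @standard n b u z h -> @standard n b u' z' h -> u = u'.
Proof.
move=> [_ hv ho _] [_ hv' ho' _]; apply: ltree_eq => [|j]; first by rewrite hv hv'.
have [/imsetP[a _ ->]|ju] := boolP (j \in [set h a | a : 'I_(tag b)]).
  by rewrite ho ho'.
by rewrite (ltreeP u).1 ?hv // (ltreeP u').1 ?hv'.
Qed.

(** The concatenation of the increasing enumerations of the blocks of [u]. The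
    equality of sizes is part of the conclusion, as the blocks partition the
    labels. *)
Lemma shuffle_exists r n (b : 'I_r -> dtree X) (u : boxpow r n) z :
  (forall k, b k = block (u k) z) ->
  exists nN : \sum_k tag (b k) = n, exists s : 'S_(\sum_k tag (b k)),
    shuffle s /\ forall k, exists2 h : 'I_(tag (b k)) -> 'I_n,
      standard (u k) z h & forall i, cast_ord nN (s (tagnat.Rank k i)) = h i.
Proof.
move=> bE; have st k : exists h : 'I_(tag (b k)) -> 'I_n, standard (u k) z h.
  by rewrite bE; exists enum_val; apply: block_standard.
have {st}[h hP] := fin_all_exists st.
pose f (j : 'I_(\sum_k tag (b k))) := h (tagnat.sig1 j) (tagnat.sig2 j).
have fR k (i : 'I_(tag (b k))) : f (tagnat.Rank k i) = h k i.
  pose F (p : {k & 'I_(tag (b k))}) := h (tag p) (tagged p).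
  exact: (congr1 F (tagnat.rankK _)).
have huP k i : h k i \in vertices (u k).
  by have [_ -> _ _] := hP k; rewrite imset_f.
have f_inj : injective f.
  move=> i j; rewrite -[i]tagnat.sig2K -[j]tagnat.sig2K !fR.
  move: (tagnat.sig1 i) (tagnat.sig2 i) (tagnat.sig1 j) (tagnat.sig2 j) => k a l a' e.
  have kl : k = l.
    have [q hq] := boxpowP u (h k a); apply/eqP.
    have := huP k a; have := huP l a'; rewrite -e !hq => /eqP -> /eqP ->.
    by [].
  by subst l; have [/increasing_inj/(_ _ _ e) -> _ _ _] := hP k.
have f_surj j : exists i, f i = j.
  have [k hk] := boxpowP u j; have := hk k; rewrite eqxx.
  have [_ -> _ _] := hP k => /imsetP[i _ ->].
  by exists (tagnat.Rank k i); rewrite fR.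
have [g gK] := boolp.choice f_surj.
have g_inj : injective g by move=> i j e; rewrite -[i]gK e gK.
have nN : \sum_k tag (b k) = n.
  have := leq_card _ f_inj; have := leq_card _ g_inj; rewrite !card_ord => gle fle.
  by apply/eqP; rewrite eqn_leq fle gle.
exists nN; have f'_inj : injective (fun j => cast_ord (esym nN) (f j)).
  by move=> i j /cast_ord_inj /f_inj.
exists (perm f'_inj); split=> [|k].
  apply/forallP => k; apply/forallP => i; apply/forallP => j; apply/implyP => ij.
  by rewrite !permE /= !fR; have [hi _ _ _] := hP k; apply: hi.
by exists (h k) => // i; rewrite permE -fR; apply: cast_ordKV.
Qed.

End Blocks.

Section Coefficients.
Variables (X : choiceType) (K : comPzRingType).

(** At most one index contributes; the sum counts it if it satisfies [P]. *)
Lemma fm_coeff_sum1 (I : finType) (B : choiceType) (P : pred I) (F : I -> B) b i0 :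
  (forall i, P i -> F i = b <-> i = i0) ->
  (\sum_(i | P i) (fm_elt (F i) : freemod K B))@_b = (P i0)%:R.
Proof.
move=> Fb; rewrite fm_coeff_sum; under eq_bigr => i _ do rewrite fm_coeff_elt.
case: (boolP (P i0)) => [Pi0|Pi0]; last first.
  rewrite big1 // => i Pi; case: eqP => // /(Fb i Pi) e.
  by rewrite e (negbTE Pi0) in Pi.
rewrite (bigD1 i0) //= ((Fb i0 Pi0).2 erefl) eqxx big1 ?addr0 // => i /andP[Pi /eqP ii0].
by case: eqP => // /(Fb i Pi).
Qed.

Lemma lin_ext_delta (I J : choiceType) (f : I -> freemod K J) (g : freemod K I) j i0 :
  (forall i, (f i)@_j = (i == i0)%:R) -> (lin_ext f g)@_j = g@_i0.
Proof.
move=> fj; rewrite /lin_ext fm_coeff_sum.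
under eq_bigr => i _ do rewrite fm_coeffZ fj.
have [ig|ig] := boolP (i0 \in msupp g).
  rewrite (big_fsetD1 i0) //= eqxx mulr1 big_seq big1 ?addr0 // => i.
  by rewrite in_fsetD1 => /andP[/negbTE -> _]; rewrite mulr0.
rewrite (mcoeff_outdom ig) big_seq big1 // => i i_g.
by case: eqP => [e|_]; rewrite ?mulr0 //; rewrite -e i_g in ig.
Qed.

Lemma mk_dtree_inj (Y : choiceType) n t t' (x x' : n.-tuple Y) :
  mk_dtree t x = mk_dtree t' x' -> t = t' /\ x = x'.
Proof. by move=> e; have := eq_from_Tagged e => -[-> ->]. Qed.

Lemma mk_dforest_inj r n t t' (u u' : boxpow r n) (x x' : n.-tuple X) :
  mk_dforest t u x = mk_dforest t' u' x' -> [/\ t = t', u = u' & x = x'].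
Proof. by move=> e; have [] := eq_from_Tagged (eq_from_Tagged e). Qed.

(** Two shuffles with the same effect agree on each block by uniqueness of
    increasing enumerations, hence the coefficients are 0 or 1. *)
Lemma box_sum_coeff r (t t' : RT r) (b : 'I_r -> dtree X) n (u : boxpow r n) (x : n.-tuple X) :
  (box_sum K t b)@_(mk_dforest t' u x)
    = ((t == t') && [forall k, b k == block (u k) (tnth x)])%:R.
Proof.
have key s : shuffle s ->
    mk_dforest t (box_act s (juxtapose b)) (word_act s (concat b)) = mk_dforest t' u x ->
    t = t' /\ forall k, b k = block (u k) (tnth x).
  move=> sh e; have nN := congr1 (fun y : dforest X => tag (tagged y)) e.
  rewrite /= in nN; subst n; have [-> <- <-] := mk_dforest_inj e; split=> // k.
  exact: standard_block (shuffle_standard k sh).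
case: andP => [[/eqP <- /forallP bE]|bE]; last first.
  rewrite /box_sum fm_coeff_sum big1 // => s sh; rewrite fm_coeff_elt.
  case: eqP => // /(key s sh) [tt' be]; case: bE; rewrite tt' eqxx; split=> //.
  by apply/forallP => k; apply/eqP.
have {}bE k : b k = block (u k) (tnth x) by apply/eqP.
have [nN [s0 [sh0 s0P]]] := shuffle_exists bE; subst n.
rewrite (fm_coeff_sum1 (i0 := s0)) ?sh0 // => s sh; split=> [e|->].
  have [_ ue xe] := mk_dforest_inj e; apply/permP => i; rewrite -[i]tagnat.sig2K.
  move: (tagnat.sig1 i) (tagnat.sig2 i) => k a.
  have [hi hv _ _] := shuffle_standard k sh; have [h [hi' hv' _ _] hs0] := s0P k.
  transitivity (h a); last by rewrite -hs0 cast_ord_id.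
  by apply: (increasing_uniq hi hi'); rewrite -hv -hv' ue.
congr mk_dforest.
  apply/val_inj/ffunP => k; have [h hst hs0] := s0P k.
  apply: ltree_standard hst; have := shuffle_standard k sh0.
  by congr standard; apply/funext => a; rewrite -hs0 cast_ord_id.
apply: eq_from_tnth => i; rewrite -[i](permKV s0) -[s0^-1%g i]tagnat.sig2K.
move: (tagnat.sig1 _) (tagnat.sig2 _) => k a; have [_ _ _ ->] := shuffle_standard k sh0.
by have [h [_ _ _ hz] hs0] := s0P k; rewrite -hz -hs0 cast_ord_id.
Qed.

Lemma mem_orbit_seq (c : dclass X) b : (b \in orbit_seq (repr c)) = (\pi_(dclass X) b == c).
Proof.
have -> : (\pi_(dclass X) b == c) = (\pi_(dclass X) (repr c) == \pi b).
  by rewrite reprK eq_sym.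
rewrite mem_undup eqquotE; apply/mapP/idP => /= [[s _ ->]|].
  by apply/existsP; exists s.
by move=> /existsP[s /eqP <-]; exists s; rewrite ?mem_enum.
Qed.

(** The decorated tree of orbits from which a forest arises by expansion. *)
Definition collapse (y : dforest X) : dtree (dclass X) :=
  let: (t, u, x) := tagged (tagged y) in
  mk_dtree t [tuple \pi_(dclass X) (block (u k) (tnth x)) | k < tag y].

Lemma expand_coeff (w : dtree (dclass X)) (y : dforest X) :
  (expand K w)@_y = (w == collapse y)%:R.
Proof.
case: w y => r [t c] [r' [n [[t' u] x]]]; rewrite /expand /collapse /= fm_coeff_sum.
have [rr'|rr'] := eqVneq r r'; last first.
  rewrite big1 => [|b _]; first by case: eqP => // /(congr1 tag)/eqP; rewrite (negbTE rr').
  rewrite /box_sum fm_coeff_sum big1 // => s _; rewrite fm_coeff_elt.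
  by case: eqP => // /(congr1 tag)/eqP /=; rewrite (negbTE rr').
subst r'; under eq_bigr => b _ do rewrite (box_sum_coeff _ t').
set c' := [tuple _ | _ < _].
have -> : (existT _ r (t, c) == mk_dtree t' c' :> dtree (dclass X)) = (t == t') && (c == c').
  apply/eqP/andP => [e|[/eqP -> /eqP ->]] //.
  by have [-> ->] := eq_from_Tagged e; rewrite !eqxx.
have [_|_] /= := eqVneq t t'; last by rewrite big1.
case: eqP => [cc'|cc']; last first.
  rewrite big1 // => b _; case: forallP => // be; case: cc'.
  apply: eq_from_tnth => k; rewrite tnth_mktuple; have /eqP <- := be k.
  by have := ssvalP (b k); rewrite mem_orbit_seq => /eqP.
have bP k : block (u k) (tnth x) \in orbit_seq (repr (tnth c k)).
  by rewrite mem_orbit_seq cc' tnth_mktuple.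
pose b0 : {dffun forall k : 'I_r, seq_sub (orbit_seq (repr (tnth c k)))} :=
  finfun (fun k => SeqSub (bP k)).
rewrite (bigD1 b0) //= big1 ?addr0 => [|b bb0].
  by case: forallP => // [[]] k; rewrite ffunE.
case: forallP => // be; case/eqP: bb0; apply/ffunP => k; rewrite ffunE; apply/val_inj.
exact: (eqP (be k)).
Qed.

Lemma expand_collapse (G : freemod K (dtree (dclass X))) (y : dforest X) :
  (lin_ext (@expand K X) G)@_y = G@_(collapse y).
Proof. by apply: lin_ext_delta => w; apply: expand_coeff. Qed.

Lemma collapse_act r n (t : RT r) (u : boxpow r n) (x : n.-tuple X) (s : 'S_r) :
  collapse (dforest_act (y := mk_dforest t u x) s)
    = dtree_act (b := collapse (mk_dforest t u x)) s.
Proof.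
rewrite /collapse /dforest_act /dtree_act /=; congr mk_dtree.
by apply: eq_from_tnth => k; rewrite !tnth_mktuple ffunE.
Qed.

End Coefficients.
(** * Grafting a forest on a root *)

Section Grafting.
Variables (X : choiceType) (K : comPzRingType).

(** [t] is a corolla with root [rho], up to the labelling, and [v] is the only
    vertex of the root block. The labelling of [t] is arbitrary because
    [trace_inv] sees arbitrary representatives of the orbits. *)
Definition corolla_forest r n (t : RT r) (u : boxpow r n) (rho : 'I_r) (v : 'I_n) :=
  (forall k, out t k = if k == rho then None else Some rho)
  /\ vertices (u rho) = [set v].

(** The unique tree that the corolla forest composes to is [w]. *)
Definition grafts r n (t : RT r) (u : boxpow r n) rho v (w : RT n) :=
  corolla_forest t u rho v /\
  forall k j, j \in vertices (u k) ->
    out w j = if out (u k) j is Some l then Some l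
              else if k == rho then None else Some v.

Section Substitution.
Variables (r n : nat) (t : RT r) (u : boxpow r n) (rho : 'I_r) (v : 'I_n).
Hypothesis tu : corolla_forest t u rho v.

Let label := ('I_r + 'I_n)%type.

(** [W] is the result of substituting the blocks for the vertices [k] of [t] such
    that [P k]. The current root [R] is [v] as soon as the root block has been
    substituted. *)
Definition substituted (P : pred 'I_r) (W : ltree label) : Prop :=
  let R : label := if P rho then inr v else inl rho in
  [/\ forall k, (inl k \in vertices W) = ~~ P k,
      forall k j, j \in vertices (u k) -> (inr j \in vertices W) = P k,
      forall k, out W (inl k) =
        if P k then None else if k == rho then None else Some R
    & forall k j, j \in vertices (u k) -> out W (inr j) =
        if P k then
          if out (u k) j is Some l then Some (inr l)
          else if k == rho then None else Some R
        else None].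

(** There is just one way to attach the incoming edges of [k]: there are none,
    unless [k] is the root of [t], in which case they all go to [v]. *)
Lemma substituted_step P W k : substituted P W -> ~~ P k ->
  exists W', Defs.pcomp K W (inl k) (relabel (@inr_inj' r n) (u k)) = fm_elt W' /\
    substituted (predU1 k P) W'.
Proof.
case=> Wl Wr Wol Wor Pk; have [tE urho] := tu.
set u' := relabel _ _; set In := In_edges W (inl k).
have InE j : (j \in In) = (out W j == Some (inl k)).
  by rewrite inE; case: eqP => [/out_vertices[-> _]|]; rewrite ?andbF.
have u'l l : inl l \in vertices u' = false.
  by rewrite vertices_relabel; apply/negP => /imsetP[].
have u'r j : inr j \in vertices u' = (j \in vertices (u k)).
  by rewrite vertices_relabel mem_imset //; apply: inr_inj'.
have In_rho j : j \in In -> k = rho.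
  rewrite InE; case: j => [l|j].
    rewrite Wol; case: (P l) => //; case: (l == rho) => //.
    by case: (P rho) => // /eqP[].
  have [l hl] := boxpowP u j; rewrite (Wor l) ?hl ?eqxx //.
  case: (P l) => //; case: (out _ j) => //; case: (l == rho) => //.
  by case: (P rho) => // /eqP[].
(* The only function that indexes a term of the partial composition. *)
pose f0 := [ffun j => if j \in In then inr v else inl k : label].
have f0P f : (f \in pffun_on (inl k) (mem In) (mem (vertices u'))) = (f == f0).
  apply/pffun_onP/eqP => [[/supportP fs fim]|->].
    apply/ffunP => j; rewrite ffunE; case: ifPn => [jIn|/fs //].
    have : f j \in vertices u' by apply: fim; apply: image_f.
    have := In_rho _ jIn => kr; case: (f j) => [l|i]; first by rewrite u'l.
    by rewrite u'r kr urho => /set1P ->.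
  split; first by apply/supportP => j /negbTE; rewrite ffunE => ->.
  move=> _ /imageP[j jIn ->]; rewrite ffunE jIn u'r (In_rho _ jIn) urho.
  exact: set11.
have kW : inl k \in vertices W by rewrite Wl.
have dis : [disjoint vertices W & vertices u'].
  rewrite disjoint_sym; apply/pred0P => -[l|j] /=; first by rewrite u'l.
  by rewrite u'r; apply/negP => /andP[/Wr ->]; apply/negP.
have W't : is_ltree (subst_val W (inl k) u' f0).
  by apply: subst_is_ltree => //; rewrite f0P.
exists (LTree W't); split.
  rewrite /Defs.pcomp (big_pred1 f0) => [|f]; last exact: f0P.
  by rewrite (big_pred1 (LTree W't)).
set W' := LTree W't.
have W'V j : (j \in vertices W') = (j != inl k) && (j \in vertices W) || (j \in vertices u').
  by rewrite /vertices /= in_setU in_setD1.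
have W'o j : j \notin vertices u' -> j != inl k ->
    out W' j = if out W j == Some (inl k) then Some (inr v) else out W j.
  move=> ju jk; rewrite -[out W' j]/((subst_val W (inl k) u' f0).2 j) ffunE.
  by rewrite (negbTE ju) (negbTE jk) -InE; case: ifP => // jIn; rewrite ffunE jIn.
pose R := if P rho then inr v else inl rho : label.
have RE : (if Some R == Some (inl k) then Some (inr v) else Some R)
    = Some (if predU1 k P rho then inr v else inl rho : label).
  rewrite /R /=; have [rk|rk] /= := eqVneq rho k.
    by rewrite rk (negbTE Pk) eqxx.
  case: (P rho) => //; case: eqP => // -[] e; by rewrite e eqxx in rk.
split.
- by move=> l; rewrite W'V u'l orbF Wl /= negb_or.
- move=> l j jl; rewrite W'V u'r (Wr l) //= orbC; congr (_ || _).
  have [q hq] := boxpowP u j; move: jl; rewrite !hq => /eqP ->.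
  by rewrite eq_sym.
- move=> l; rewrite /=; have [->|lk] := eqVneq l k.
    by rewrite /out /= ffunE u'l eqxx.
  rewrite W'o ?u'l //=.
  by rewrite Wol; case: (P l) => //; case: (l == rho).
move=> l j jl; have [lk|lk] := eqVneq l k.
  subst l; rewrite /= eqxx /= /out /= ffunE u'r jl out_relabel.
  rewrite -/(out (u k) j) -/(out W (inl k)); case: (out _ j) => //=.
  rewrite Wol (negbTE Pk); by case: eqVneq.
have jk : j \notin vertices (u k).
  by have [q hq] := boxpowP u j; move: jl lk; rewrite !hq => /eqP <-; rewrite eq_sym.
rewrite W'o ?u'r //= (negbTE lk) /= (Wor l) //.
by case: (P l) => //; case: (out _ j) => [i|] //; case: (l == rho).
Qed.

Lemma comp_sum_corolla :
  exists2 W, comp_sum K t u = fm_elt W & substituted predT W.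
Proof.
have [tE urho] := tu.
have W0 : substituted pred0 (relabel (@inl_inj' r n) t).
  have inrN j : inr j \notin vertices (relabel (@inl_inj' r n) t).
    by rewrite vertices_relabel; apply/negP => /imsetP[].
  split=> [k|k j _|k|k j _] /=.
  - by rewrite vertices_relabel mem_imset ?vertices_RT ?inE //; apply: inl_inj'.
  - exact/negbTE.
  - by rewrite out_relabel tE; case: eqP.
  by rewrite (ltreeP _).1.
rewrite /comp_sum; set F := (X in foldl X).
have FE k W W' : Defs.pcomp K W (inl k) (relabel (@inr_inj' r n) (u k)) = fm_elt W' ->
    F (fm_elt W) k = fm_elt W'.
  by apply: etrans; apply: lin_ext_elt.
have fold s P W : substituted P W -> uniq s -> {in s, forall k, ~~ P k} ->
    exists2 W', foldl F (fm_elt W) s = fm_elt W' & substituted (fun k => P k || (k \in s)) W'.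
  elim: s P W => [|k s IH] P W PW /=.
    exists W => //; suff -> : (fun k => P k || (k \in [::])) = P by [].
    by apply/funext => k; rewrite in_nil orbF.
  move=> /andP[ks us] sP.
  have [W1 [e PW1]] := substituted_step PW (sP k (mem_head _ _)).
  rewrite (FE _ _ _ e).
  have [|W' -> PW'] := IH _ _ PW1 us.
    move=> l ls; rewrite /= negb_or sP ?inE ?ls ?orbT // andbT.
    by apply: contraNneq ks => <-.
  exists W'; first reflexivity.
  suff <- : (fun l => predU1 k P l || (l \in s)) = (fun l => P l || (l \in k :: s)) by [].
  by apply/funext => l; rewrite /= inE orbA [_ || P l]orbC.
have [|W e PW] := fold (enum 'I_r) _ _ W0 (enum_uniq _); first by [].
exists W; first exact: e.
suff <- : (fun k => pred0 k || (k \in enum 'I_r)) = predT by [].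
by apply/funext => k; rewrite /= mem_enum.
Qed.

Lemma compose_corolla (x : n.-tuple X) (b : dtree X) :
  (compose K (mk_dforest t u x))@_b
    = `[< exists2 w, b = mk_dtree w x & grafts t u rho v w >]%:R.
Proof.
have [W WE [Wl Wr Wol Wor]] := comp_sum_corolla.
have WP (w : RT n) : W = relabel (@inr_inj' r n) w <-> grafts t u rho v w.
  split=> [e|[_ gr]].
    split=> // k j ju; have := Wor k j ju; rewrite e out_relabel /=.
    case: (out (u k) j) => [l|]; first by case: (out w j) => // l' [->].
    by case: eqP => _; case: (out w j) => // l' [->].
  apply: ltree_eq => [|[k|j]].
  - apply/setP => -[k|j]; rewrite vertices_relabel vertices_RT.
      by rewrite Wl; apply/esym/negbTE/negP => /imsetP[].
    have [k hk] := boxpowP u j; rewrite (Wr k) ?hk // mem_imset ?inE //.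
    exact: inr_inj'.
  - rewrite Wol; case e: (out _ _) => [l|] //.
    by have [a [b' []]] := relabel_out e.
  have [k hk] := boxpowP u j; have jk : j \in vertices (u k) by rewrite hk.
  rewrite out_relabel (gr k) // (Wor k) //=.
  by case: (out _ j) => //; case: eqP.
rewrite /compose /= /op_comp WE linear_sum fm_coeff_sum.
under eq_bigr => w _ do rewrite linearZ /= lin_ext_elt fm_coeffZ !fm_coeff_elt.
case: asboolP => [[w -> wP]|no].
  rewrite (bigD1 w) //= big1 ?addr0 => [|w' /eqP ww'].
    by rewrite ((WP w).2 wP) !eqxx mulr1.
  case: eqP => [/WP gw'|]; last by rewrite mul0r.
  case: (_ =P mk_dtree w x) => [e|]; last by rewrite mulr0.
  by case: ww'; have [] := mk_dtree_inj e.
apply: big1 => w _; case: eqP => [/WP gw|]; last by rewrite mul0r.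
by case: eqP => [e|]; [case: no; exists w|rewrite mulr0].
Qed.

End Substitution.

Section GraftedBlocks.
Variables (r n : nat) (t : RT r) (u : boxpow r n) (rho : 'I_r) (v : 'I_n) (w : RT n).
Hypothesis gr : grafts t u rho v w.

Lemma grafts_root : out (u rho) v = None.
Proof.
have [[_ urho] _] := gr; have [i] := ltree_root (u rho).
by rewrite urho => /set1P ->.
Qed.

Lemma grafts_rootw : out w v = None.
Proof.
have [[_ urho] gP] := gr; rewrite (gP rho) ?urho ?set11 //.
by rewrite grafts_root eqxx.
Qed.

(** Cutting the edges into the root [v] of [w] gives back the blocks. *)
Lemma grafts_out k j : j \in vertices (u k) ->
  out (u k) j = if out w j is Some b then if b == v then None else Some b else None.
Proof.
have [[_ urho] gP] := gr => jk; rewrite (gP k j jk).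
case e: (out (u k) j) => [l|]; last by case: (k == rho); rewrite ?eqxx.
case: eqP => // lv; subst l; have [_ vk] := out_vertices e.
have vr : v \in vertices (u rho) by rewrite urho set11.
have [q hq] := boxpowP u v; move: vk vr; rewrite !hq => /eqP kq /eqP rq.
move: jk e; rewrite kq -rq urho => /set1P ->.
by rewrite grafts_root.
Qed.

End GraftedBlocks.

(** Within a block, every vertex is joined to the root of the block by edges of
    [w] which do not enter the root of [w]; hence two forests composing to the
    same tree have the same blocks. *)
Lemma grafts_block_sub r r' n (t : RT r) (u : boxpow r n) rho v
    (t' : RT r') (u' : boxpow r' n) rho' (w : RT n) k k' j j' :
  grafts t u rho v w -> grafts t' u' rho' v w ->
  j \in vertices (u k) -> j' \in vertices (u k) ->
  j \in vertices (u' k') -> j' \in vertices (u' k').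
Proof.
move=> gr gr'; have [_ [i [iu iN] ic]] := ltreeP (u k).
have ji a : a \in vertices (u k) -> (a \in vertices (u' k')) = (i \in vertices (u' k')).
  move=> /ic /connectP[s]; elim: s a => [|b s IH] a /=; first by move=> _ ->.
  move=> /andP[/eqP ab /IH{}IH /IH <-]; have [au bu] := out_vertices ab.
  have [l hl] := boxpowP u' a; have au' : a \in vertices (u' l) by rewrite hl.
  have : out (u' l) a = Some b by rewrite (grafts_out gr' au') -(grafts_out gr au).
  move=> /out_vertices[_ bu'].
  have [m hm] := boxpowP u' b; move: bu'; rewrite hl !hm => /eqP ->.
  by [].
by move=> /ji -> /ji ->.
Qed.

(** The two forests induce the same partition of the labels; the permutation
    matches the indices of the blocks. *)
Lemma grafts_perm r r' n (t : RT r) (u : boxpow r n) rho v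
    (t' : RT r') (u' : boxpow r' n) rho' v' (w : RT n) (x : n.-tuple X) :
  grafts t u rho v w -> grafts t' u' rho' v' w ->
  exists s, dforest_act (y := mk_dforest t u x) s = mk_dforest t' u' x.
Proof.
move=> gr gr'; have vv' : v' = v.
  apply: (@ltree_root_uniq _ w); rewrite ?vertices_RT ?inE //.
    exact: grafts_rootw gr.
  exact: grafts_rootw gr'.
subst v'.
have [ka kaP] := boolp.choice (boxpowP u); have [ka' kaP'] := boolp.choice (boxpowP u').
have sur q (b : boxpow q n) k : exists j, j \in vertices (b k).
  by have [j jk _] := ltree_root (b k); exists j.
have [rp rpP] := boolp.choice (sur _ u); have [rp' rpP'] := boolp.choice (sur _ u').
have ka_eq i j : ka i = ka j <-> ka' i = ka' j.
  split=> [e|e]; apply/eqP.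
    by rewrite -kaP'; apply: (grafts_block_sub gr gr' (j := i) (k := ka i));
       rewrite ?kaP ?kaP' ?e.
  by rewrite -kaP; apply: (grafts_block_sub gr' gr (j := i) (k := ka' i));
     rewrite ?kaP ?kaP' ?e.
have karp k : ka (rp k) = k by apply/eqP; rewrite eq_sym -kaP.
have karp' k : ka' (rp' k) = k by apply/eqP; rewrite eq_sym -kaP'.
have f_inj : injective (ka' \o rp) by move=> k l /ka_eq; rewrite !karp.
have f_inj' : injective (ka \o rp') by move=> k l /ka_eq; rewrite !karp'.
have rr' : r = r'.
  have := leq_card _ f_inj; have := leq_card _ f_inj'; rewrite !card_ord => gle fle.
  by apply/eqP; rewrite eqn_leq fle gle.
subst r'; pose s := perm f_inj.
have sE j : s (ka j) = ka' j by rewrite permE; apply/ka_eq; rewrite karp.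
have [[tE urho] _] := gr; have [[tE' urho'] _] := gr'.
have srho : s rho = rho'.
  have /eqP -> : rho == ka v by rewrite -kaP urho set11.
  by rewrite sE; apply/esym/eqP; rewrite -kaP' urho' set11.
exists s; congr mk_dforest.
  apply/RT_eq => k; rewrite -[k](permKV s); move: (s^-1%g k) => {}k.
  rewrite out_relabel tE tE' -srho (inj_eq perm_inj).
  by case: ifP.
apply/val_inj/ffunP => k; rewrite -[k](permKV s); move: (s^-1%g k) => {}k.
rewrite ffunE permK; have vE j : (j \in vertices (u k)) = (j \in vertices (u' (s k))).
  by rewrite kaP kaP' -sE (inj_eq perm_inj).
apply: ltree_eq => [|j]; first exact/setP.
have [jk|jk] := boolP (j \in vertices (u k)).
  by rewrite (grafts_out gr jk) (grafts_out gr') // -vE.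
by rewrite (ltreeP _).1 // (ltreeP (u' _)).1 // -vE.
Qed.

(** Composing commutes with the permutation of the blocks, for corolla forests. *)
Lemma grafts_act r n (t : RT r) (u : boxpow r n) rho v (s : 'S_r) rho' v' (w : RT n) :
  corolla_forest t u rho v ->
  grafts (rt_act s t) (box_perm s u) rho' v' w -> grafts t u rho v w.
Proof.
move=> tu [[tE' urho'] gP]; have [tE urho] := tu.
have srho : s rho = rho'.
  have := tE' (s rho); rewrite out_relabel tE eqxx /=.
  by case: eqP.
have vv' : v = v'.
  by apply/set1P; rewrite -urho' -srho ffunE permK urho set11.
split=> // k j jk; rewrite (gP (s k)); last by rewrite ffunE permK.
by rewrite ffunE permK -srho (inj_eq perm_inj) vv'.
Qed.

(** Both sides are 1 if the forest composes to [w], and 0 otherwise: the orbit of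
    a forest is free, and it contains the reference forest over [w] exactly when
    the forest composes to [w]. *)
Lemma compose_trace r n (t : RT r) (u : boxpow r n) (x : n.-tuple X) rho v
    r' n' (t' : RT r') (u' : boxpow r' n') (x' : n'.-tuple X) rho' v' (w : RT n') :
  corolla_forest t u rho v -> grafts t' u' rho' v' w ->
  (compose K (mk_dforest t u x))@_(mk_dtree w x')
    = (\sum_(s : 'S_r) fm_elt (dforest_act (y := mk_dforest t u x) s) :
         freemod K (dforest X))@_(mk_dforest t' u' x').
Proof.
move=> tu gr'; rewrite (compose_corolla tu).
case: asboolP => [[w0 e gr]|no].
  have nn' : n' = n := congr1 tag e; subst n'.
  have [ww' xx'] := mk_dtree_inj e; subst w0 x'.
  have [s0 s0P] := grafts_perm x gr gr'.
  rewrite (@fm_coeff_sum1 K _ _ _ _ _ s0) // => s _; split=> [|-> //].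
  by rewrite -s0P => /dforest_act_inj.
rewrite fm_coeff_sum big1 // => s _; rewrite fm_coeff_elt; case: eqP => // e.
have rr' : r = r' := congr1 tag e; subst r'.
have nn' : n = n' := congr1 (fun y : dforest X => tag (tagged y)) e; subst n'.
have [ts us xs] := mk_dforest_inj e; subst t' u' x'.
by case: no; exists w => //; apply: grafts_act gr'.
Qed.

End Grafting.
(** * The value of a monomial *)

Section Value.
Variable X : choiceType.

Section Coefficient.
Variable K : comPzRingType.

Lemma trace_inv_supp (g : freemod K (dforest X)) y :
  y \in msupp (trace_inv g) -> g@_y != 0.
Proof.
rewrite -mcoeff_neq0; apply: contra => /eqP gy; apply/eqP.
rewrite /trace_inv fm_coeff_sum big1 // => y' _; rewrite fm_coeffZ fm_coeff_elt.
by case: eqP => [->|_]; rewrite ?gy ?mul0r ?mulr0.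
Qed.

(** Pairing with the reference forest over [w] turns composition into the trace,
    so that [trace_inv] cancels. *)
Lemma mu_tilde_coeff (G : freemod K (dtree (dclass X)))
    r n (t : RT r) (u : boxpow r n) (x : n.-tuple X) rho v (w : RT n) :
  Gamma G ->
  (forall r n (t : RT r) (u : boxpow r n) (x : n.-tuple X),
     G@_(collapse (mk_dforest t u x)) != 0 -> exists rho v, corolla_forest t u rho v) ->
  grafts t u rho v w ->
  (mu_tilde G)@_(mk_dtree w x) = G@_(collapse (mk_dforest t u x)).
Proof.
move=> GG Gcor gr; rewrite -expand_collapse /mu_tilde.
set g := lin_ext _ G; have ginv y s : g@_(dforest_act (y := y) s) = g@_y.
  case: y s => r' [n' [[t' u'] x']] s; rewrite !expand_collapse collapse_act.
  exact: GG.
rewrite -{2}(trace_invK ginv) /trace /lin_ext !fm_coeff_sum.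
rewrite big_seq [RHS]big_seq; apply: eq_bigr => -[r' [n' [[t' u'] x']]].
move=> /trace_inv_supp; rewrite expand_collapse => /Gcor[rho' [v' tu']].
by rewrite !fm_coeffZ (compose_trace K x' x tu' gr).
Qed.

End Coefficient.

Lemma same_orbitE (b c : dtree X) : same_orbit b c <-> \pi_(dclass X) b = \pi_(dclass X) c.
Proof.
split=> [|/(@eqquotP _ _ (dclass X)) //]; exact: same_orbit_pi.
Qed.

Lemma orbit_tag (Y : choiceType) (b c : dtree Y) : same_orbit b c -> tag b = tag c.
Proof. by case: b => n [t x] /same_orbitP[s ->]. Qed.

Lemma single_inj : injective (@single X).
Proof.
move=> x y /same_orbitE /same_orbitP[s e].
have [_ xy] := mk_dtree_inj e; have := congr1 (fun z : 1.-tuple X => tnth z ord0) xy.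
by rewrite tnth_mktuple !(tnth_nth x) !ord1.
Qed.

Lemma corolla_out r k : out (corolla r) k = if k == ord0 then None else Some ord0.
Proof. by rewrite /out /= ffunE. Qed.

Section Decomposition.
Variables (n : nat) (w : RT n) (z : 'I_n -> X).

Let under := connect [rel a b | out w a == Some b].

(** The branch above [i], on the vertices [j] with a path to [i]. *)
Definition branch_val i : {set 'I_n} * {ffun 'I_n -> option 'I_n} :=
  ([set j | under j i], [ffun j => if (j != i) && under j i then out w j else None]).

Lemma under_step i a b : out w b = Some a -> under a i -> b != i /\ under b i.
Proof.
move=> ba ai; split; last by apply: connect_trans ai; apply: connect1; rewrite /= ba.
by apply: contraTneq ai => <-; apply: out_acyclic ba.
Qed.

Lemma under_out i j : under j i -> j != i -> exists2 k, out w j = Some k & under k i.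
Proof.
move=> /connectP[[|k p] /=]; first by move=> _ ->; rewrite eqxx.
by move=> /andP[/eqP jk kp] ip _; exists k => //; apply/connectP; exists p.
Qed.

Lemma branch_is_ltree i : is_ltree (branch_val i).
Proof.
apply: is_ltreeP => [j|]; first by rewrite inE ffunE => /negbTE ->; rewrite andbF.
exists i; first by rewrite inE ffunE eqxx; split=> //; apply: connect0.
move=> j; rewrite inE => /connectP[p]; elim: p j => [|k p IH] j /=.
  by move=> _ ->; apply: connect0.
move=> /andP[/eqP jk kp] ip; apply: connect_trans (IH _ kp ip).
have ki : under k i by apply/connectP; exists p.
by have [ji jui] := under_step jk ki; apply: connect1; rewrite /= ffunE ji jui jk.
Qed.

Definition branch i : ltree 'I_n := LTree (branch_is_ltree i).

Lemma vertices_branch i j : (j \in vertices (branch i)) = under j i.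
Proof. by rewrite inE. Qed.

Lemma out_branch i j : out (branch i) j = if (j != i) && under j i then out w j else None.
Proof. by rewrite /out /= ffunE. Qed.

Lemma point_is_ltree i : is_ltree ([set i], [ffun _ : 'I_n => None]).
Proof.
apply: is_ltreeP => [j _|]; first by rewrite ffunE.
by exists i => [|j /set1P ->]; rewrite ?set11 ?ffunE ?connect0.
Qed.

Definition point i : ltree 'I_n := LTree (point_is_ltree i).

Lemma block_point i : block (point i) z = mk_dtree (corolla 0) [tuple z i].
Proof.
apply/esym/(@standard_block _ _ _ _ _ (fun=> i)); split.
- by move=> a b; rewrite !ord1.
- apply/setP => j; apply/set1P/imsetP => [->|[_ _ ->]] //.
  by exists ord0.
- by move=> a; rewrite corolla_out ord1 /out /= ffunE.
by move=> a; rewrite ord1.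
Qed.

Lemma shape_branch i M : shape (out w) z i M -> shape (out (branch i)) z i M.
Proof.
apply: (@shape_morph _ _ _ _ _ _ _ id (fun j => under j i)) => //; last exact: connect0.
  move=> a b ai ba; have [bi bui] := under_step ba ai.
  by rewrite out_branch bi bui.
by move=> a j ai; rewrite out_branch; case: ifP => // _ ja; exists j.
Qed.

Lemma block_shape (u : ltree 'I_n) i M : i \in vertices u -> out u i = None ->
  shape (out u) z i M -> has_shape (block u z) M.
Proof.
move=> iu iN iM; have [N bN] := has_shape_exists (block u z).
have [hi hv ho hz] := block_standard u z; have h_inj := increasing_inj hi.
apply/(has_shape_uniq _ bN); case: bN => i0 i0N i0s.
have h0 : enum_val i0 = i.
  apply: (ltree_root_uniq iu iN); first exact: enum_valP.
  by have := ho i0; rewrite i0N.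
apply: (@shape_uniq _ _ (out u) z i) => //; rewrite -h0.
apply: (@shape_morph _ _ _ _ _ _ _ enum_val (fun=> True)) i0s => //.
  by move=> a b _ ba; split=> //; have := ho b; rewrite /= ba.
move=> a j _ ja; have [ju _] := out_vertices ja; pose b := enum_rank_in ju j.
have jb : enum_val b = j by rewrite enum_rankK_in.
exists b => //; have := ho b; rewrite jb ja.
by case: (out _ b) => //= b' [/h_inj ->].
Qed.

(** The blocks are the root of [w] and the branches above its children, in the
    order in which the shape lists them. *)
Lemma decompose i x r (M : 'I_r -> monomial X) :
  out w i = None -> shape (out w) z i (Monomial x M) ->
  exists u : boxpow r.+1 n,
    [/\ grafts (corolla r) u ord0 i w, block (u ord0) z = mk_dtree (corolla 0) [tuple x]
      & forall k, has_shape (block (u (lift ord0 k)) z) (M k)].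
Proof.
move=> iN [<- [c [c_inj cP cM]]].
have ci k : out w (c k) = Some i by apply/cP; exists k.
have iw j : j \in vertices w by rewrite vertices_RT inE.
have under_c_uniq j k l : under j (c k) -> under j (c l) -> k = l.
  have to_iter a b : under a b -> exists m, iter m (obind (out w)) (Some a) = Some b.
    move=> /connectP[p]; elim: p a => [|a' p IH] a; first by move=> _ ->; exists 0.
    by move=> /andP[/eqP aa' /IH{}IH /IH[m hm]]; exists m.+1; rewrite iterSr /= aa'.
  have [d dP] := ltree_graded w.
  move=> /to_iter[m hm] /to_iter[m' hm']; apply: c_inj.
  have mm' : m = m'.
    have := graded_iter dP hm; rewrite (graded_iter dP hm') (dP _ _ (ci k)) (dP _ _ (ci l)).
    by lia.
  by move: hm; rewrite mm' hm' => -[].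
pose box := [ffun k => if unlift ord0 k is Some k' then branch (c k') else point i].
have box0 : box ord0 = point i by rewrite ffunE unlift_none.
have boxS k : box (lift ord0 k) = branch (c k) by rewrite ffunE liftK.
have ord0P (P : 'I_r.+1 -> Prop) : P ord0 -> (forall k, P (lift ord0 k)) -> forall k, P k.
  by move=> P0 PS k; case: (unliftP ord0 k) => [k'|] ->.
have iNunder k : ~~ under i (c k).
  apply/negP => /under_out[|j]; last by rewrite iN.
  by apply/eqP => e; have := ci k; rewrite -e iN.
have boxP : [forall j, #|[set k | j \in vertices (box k)]| == 1%N].
  apply: is_boxpow => j; have [->|ji] := eqVneq j i.
    exists ord0; apply: ord0P => [|k]; first by rewrite box0 eqxx inE eqxx.
    by rewrite boxS vertices_branch (negbTE (iNunder k)).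
  have [k jk] : exists k, under j (c k).
    have := ltree_root_connect (iw i) iN (iw j).
    move=> /connectP[p]; elim: p j ji => [|a p IH] j ji /=.
      by move=> _ e; rewrite e eqxx in ji.
    move=> /andP[/eqP ja /IH{}IH] ip; have [ai|ai] := eqVneq a i.
      have [k ->] : exists k, j = c k by apply/cP; rewrite ja ai.
      by exists k; apply: connect0.
    have [k ak] := IH ai ip; exists k; exact: (under_step ja ak).2.
  exists (lift ord0 k); apply: ord0P => [|l]; first by rewrite box0 inE (negbTE ji).
  rewrite boxS vertices_branch (inj_eq (@lift_inj _ _)).
  by apply/idP/eqP => [jl|-> //]; apply: under_c_uniq jl jk.
pose u := BoxPow boxP; exists u; split; first split.
- split=> [k|]; first exact: corolla_out.
  by rewrite [u _]box0.
- apply: ord0P => [j|k j]; first by rewrite [u _]box0 => /set1P ->; rewrite /out /= ffunE iN.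
  rewrite [u _]boxS vertices_branch out_branch => jk; rewrite jk andbT.
  have [->|jck] := eqVneq j (c k); first exact: ci.
  by have [l -> _] := under_out jk jck.
- by rewrite [u _]box0 block_point.
move=> k; rewrite [u _]boxS; apply: (@block_shape _ (c k)).
- by rewrite vertices_branch; apply: connect0.
- by rewrite out_branch eqxx.
by apply: shape_branch; apply: cM.
Qed.

End Decomposition.

Section Corolla.
Variable K : comPzRingType.

(** The letter at the root of the corolla is the orbit of a tree with one vertex,
    hence the root block is a singleton. *)
Lemma corolla_sum_forest x r (c : 'I_r -> dclass X) r' n (t : RT r') (u : boxpow r' n)
    (y : n.-tuple X) :
  (corolla_sum K x c)@_(collapse (mk_dforest t u y)) != 0 ->
  exists rho v, corolla_forest t u rho v.
Proof.
rewrite /corolla_sum orbit_sumE; set B := (X in nat_of_bool X).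
case: (boolP B) => [/eqP/esym e _|]; last by rewrite eqxx.
move: e => /(@eqquotP _ _ (dclass (dclass X))) /= so.
have rr' : r.+1 = r' := orbit_tag so; subst r'.
have /same_orbitP[s e] := so; have [ts us] := mk_dtree_inj e.
have : \pi_(dclass X) (block (u (s ord0)) (tnth y)) = single x.
  have := congr1 (fun z : _.-tuple _ => tnth z (s ord0)) us; rewrite !tnth_mktuple permK.
  by rewrite (tnth_nth (single x)).
move=> /same_orbitE/orbit_tag/eqP/cards1P[v uv].
exists (s ord0), v; split=> // k.
rewrite ts -[k](permKV s) out_relabel corolla_out (inj_eq perm_inj).
by case: eqP.
Qed.

(** The reference forest is chosen to follow the order of [M] if [b] has the
    expected shape. Otherwise, a relabelling that matches its collapse with the
    given corolla would fix the root and thus give a permutation of the branches,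
    and [b] would have the expected shape. *)
Lemma mu_tilde_corolla x r (c : 'I_r -> dclass X) (M : 'I_r -> monomial X) b :
  (forall k, has_shape (repr (c k)) (M k)) ->
  (mu_tilde (corolla_sum K x c))@_b = `[< has_shape b (Monomial x M) >]%:R.
Proof.
case: b => n [w z] cM; set b := existT _ _ _.
have cG : Gamma (corolla_sum K x c) by have [h _ _] := orbit_sum_basis (dclass X) K; apply: h.
have class_c k b' : has_shape b' (M k) -> \pi_(dclass X) b' = c k.
  by move=> b'M; rewrite -[c k]reprK; apply/same_orbitE; apply: same_shape_orbit b'M (cM k).
have coeff i r' (u : boxpow r'.+1 n) : grafts (corolla r') u ord0 i w ->
    (mu_tilde (corolla_sum K x c))@_b =
    (same_orbit (mk_dtree (corolla r) [tuple of single x :: [tuple c k | k < r]])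
                (collapse (mk_dforest (corolla r') u z)))%:R.
  move=> gr; rewrite (mu_tilde_coeff z cG (@corolla_sum_forest x r c) gr).
  rewrite /corolla_sum orbit_sumE eq_sym; congr (_ %:R); rewrite eqquotE.
  by [].
case: asboolP => [[i iN iM]|bM].
  have [u [gr u0 uM]] := decompose iN iM; rewrite (coeff _ _ _ gr).
  suff -> : collapse (mk_dforest (corolla r) u z)
    = mk_dtree (corolla r) [tuple of single x :: [tuple c k | k < r]].
    by case: (same_orbit_equiv (dclass X)) => refl _ _; rewrite refl.
  congr mk_dtree; apply: eq_from_tnth => k; rewrite tnth_mktuple.
  case: (unliftP ord0 k) => [k'|] ->; first by rewrite tnthS tnth_mktuple (class_c k').
  by rewrite u0.
have [[x' r' M'] [i iN iM]] := has_shape_exists b.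
have [u [gr u0 uM]] := decompose iN iM; rewrite (coeff _ _ _ gr).
case: (boolP (same_orbit _ _)) => // so; case: bM.
have [rr'] : r.+1 = r'.+1 := orbit_tag so; subst r'.
have /same_orbitP[s e] := so; have [ts us] := mk_dtree_inj e.
have s0 : s ord0 = ord0.
  have := corolla_out (s ord0); rewrite [in LHS]ts out_relabel corolla_out eqxx /=.
  by case: eqP.
have uE k : \pi_(dclass X) (block (u (s k)) (tnth z))
    = tnth [tuple of single x :: [tuple c k | k < r]] k.
  by have := congr1 (fun z : _.-tuple _ => tnth z (s k)) us; rewrite !tnth_mktuple permK.
have xx' : x' = x.
  by apply: single_inj; have := uE ord0; rewrite s0 u0.
have sl k : exists l, s (lift ord0 k) = lift ord0 l.
  case: (unliftP ord0 (s (lift ord0 k))) => [l|]; first by exists l.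
  by rewrite -{2}s0 => /perm_inj.
have [f fP] := boolp.choice sl.
have f_inj : injective f.
  by move=> k l e'; apply: (@lift_inj _ ord0); apply: (@perm_inj _ s); rewrite !fP e'.
have bM : has_shape b (Monomial x' M') by exists i.
apply/(has_shape_uniq _ bM); rewrite xx'.
apply: (@MonoEq _ _ _ _ _ (perm f_inj)^-1%g) => k.
rewrite -{1}[k](permKV (perm f_inj)); move: ((perm f_inj)^-1%g k) => {}k; rewrite permE.
apply/(has_shape_uniq _ (uM (f k))).
have := uE (lift ord0 k); rewrite fP tnthS tnth_mktuple => ce.
apply: has_shape_orbit (cM k); apply/same_orbitE.
by rewrite reprK ce.
Qed.

End Corolla.

End Value.
(** * Monomials in normal form *)

Section Evaluation.
Variables (X : choiceType) (K : comPzRingType).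

(** Over the zero ring orbit sums do not determine orbits, and the statements
    below hold because all elements coincide. *)
Lemma freemod_trivial (B : choiceType) (g g' : freemod K B) :
  1 = 0 :> K -> g = g'.
Proof. by move=> K0; apply/malgP => b; rewrite -[LHS]mul1r -[RHS]mul1r K0 !mul0r. Qed.

Lemma orbit_sum_inj : 1 != 0 :> K -> injective (@orbit_sum X K).
Proof.
move=> /eqP K1 t t' /(congr1 (fun g : freemod K _ => g@_(repr t))).
by rewrite !orbit_sumE reprK eqxx; case: eqP => // _ /K1.
Qed.

(** Orbit sums are pairwise distinct, so [orbit_class] recovers the orbits of the
    entries, and the coefficients of the corolla formula are those of the orbit
    of shape [M]. *)
Lemma ev_orbit_sum (M : monomial X) : 1 != 0 :> K ->
  exists2 t : dclass X, ev K M = orbit_sum K t & has_shape (repr t) M.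
Proof.
move=> K1; elim: M => x r M IH.
have [t tE tM] := fin_all_exists2 IH.
have evE : ev K (Monomial x M) = mu_tilde (corolla_sum K x t).
  congr (mu_tilde (corolla_sum K x _)); apply/funext => k.
  apply: (orbit_sum_inj K1); rewrite -tE.
  exact: (@classical_sets.xgetI _ _ (fun t => orbit_sum K t = ev K (M k)) (t k)).
have [b bM] := has_shape_onto (Monomial x M); exists (\pi_(dclass X) b).
  rewrite evE; apply/malgP => b'; rewrite (mu_tilde_corolla _ _ _ tM) orbit_sumE.
  congr ((nat_of_bool _)%:R); apply/asboolP/eqP => [b'M|e].
    by apply/same_orbitE; apply: same_shape_orbit b'M bM.
  by apply: has_shape_orbit bM; apply/same_orbitE.
by apply: has_shape_orbit bM; apply/same_orbitE; rewrite reprK.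
Qed.

Lemma ev_coeff (M : monomial X) (b : dtree X) : (ev K M)@_b = `[< has_shape b M >]%:R.
Proof.
have [K0|K1] := eqVneq (1 : K) 0.
  by rewrite -[LHS]mul1r -[RHS]mul1r K0 !mul0r.
have [t -> tM] := ev_orbit_sum M K1; rewrite orbit_sumE; congr ((nat_of_bool _)%:R).
apply/eqP/asboolP => [e|bM].
  by apply: has_shape_orbit tM; apply/same_orbitE; rewrite reprK.
by rewrite -[t]reprK; apply/same_orbitE; apply: same_shape_orbit bM tM.
Qed.

Lemma ev_Gamma (M : monomial X) : Gamma (ev K M).
Proof.
move=> n s t x; rewrite !ev_coeff; congr ((nat_of_bool _)%:R); apply/asboolP/asboolP.
  apply: has_shape_orbit; apply/same_orbitP; exists s^-1%g.
  by rewrite -rt_actM -word_actM mulgV rt_act1 word_act1.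
by apply: has_shape_orbit; apply/same_orbitP; exists s.
Qed.

(** The coefficient of a combination of monomials at a tree is the coefficient of
    its shape: independence holds since each monomial is a shape, and an
    invariant is constant on the trees of a given shape. *)
Lemma ev_basis : is_basis_of (@Gamma X K) (fun m : nf_monomial X => ev K (repr m)).
Proof.
(* nf sends a tree to the class of its shape, B a class to a tree of this shape. *)
have [F FP] := boolp.choice (@has_shape_exists X).
pose nf b := \pi_(nf_monomial X) (F b).
have nfP b m : has_shape b (repr m) <-> nf b = m.
  rewrite (has_shape_uniq _ (FP b)) /nf -{2}[m]reprK; split.
    by move=> h; apply/(@eqquotP _ _ (nf_monomial X)); apply/asboolP.
  by move=> /(@eqquotP _ _ (nf_monomial X))/asboolP.
have coeff (c : freemod K (nf_monomial X)) b :
    (lin_ext (fun m : nf_monomial X => ev K (repr m)) c)@_b = c@_(nf b).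
  apply: lin_ext_delta => m; rewrite ev_coeff; congr ((nat_of_bool _)%:R).
  by apply/asboolP/eqP => [/nfP ->|->] //; apply/nfP.
have [B BP] := boolp.choice (fun m : nf_monomial X => has_shape_onto (repr m)).
have nfB m : nf (B m) = m by apply/nfP.
split=> [m|c c0|v vG]; first exact: ev_Gamma.
  by apply/malgP => m; rewrite -(nfB m) -coeff c0 !mcoeff0.
pose c : freemod K (nf_monomial X) :=
  [malg m in [fset nf b | b in msupp v]%fset => v@_(B m)].
exists c; apply/malgP => b; rewrite coeff mcoeffE; case: ifP => [_|/negbT bv].
  have : same_orbit (B (nf b)) b by apply: (same_shape_orbit (BP _)); apply/nfP.
  by case: (B _) => n [t x] /same_orbitP[s ->]; rewrite vG.
by apply/mcoeff_outdom; apply: contra bv => bv; apply/imfsetP; exists b.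
Qed.

End Evaluation.

Theorem proposition5p6 (K : comPzRingType) (X : choiceType) :
  [/\ forall M : monomial X, exists t : dclass X, ev K M = orbit_sum K t,
      forall M N : monomial X, mono_eq M N -> ev K M = ev K N
    & is_basis_of (@Gamma X K) (fun m : nf_monomial X => ev K (repr m))].
Proof.
split=> [[x r M]|M N MN|]; last exact: ev_basis.
  have [K0|K1] := eqVneq (1 : K) 0; last first.
    by have [t tE _] := ev_orbit_sum (Monomial x M) K1; exists t.
  by exists (single x); apply: freemod_trivial.
apply/malgP => b; rewrite !ev_coeff; congr ((nat_of_bool _)%:R).
have NM : mono_eq N M.
  by have [_ sym _] := mono_eq_equiv X; apply/asboolP; rewrite sym; apply/asboolP.
by apply/asboolP/asboolP => bM; apply/(has_shape_uniq _ bM).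
Qed.
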